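(* Let $n,d\in\mathbb N$, $L,M,D,\varepsilon>0$ and $2^{-o(n)}\le\delta\le o(1/n)$. The class of $(\varepsilon,\delta)$-DP stochastic variational inequality problems with operators within the class $\mathcal M^1_{\mathcal W}(L,M)$, and domain $\mathcal W$ containing a Euclidean ball of diameter $D/2$, satisfies a lower bound for the weak VI gap $$\widetilde\Omega\Big(MD\Big(\frac1{\sqrt n}+\min\Big\{1,\frac{\sqrt d}{\varepsilon n}\Big\}\Big)\Big).$$
   Context: $\mathcal M^1_{\mathcal W}(L,M)$ is the set of operators $G:\mathcal W\to\mathbb R^d$ that are monotone ($\langle G(w_1)-G(w_2),w_1-w_2\rangle\ge0$), $L$-Lipschitz, and $M$-bounded ($\sup_{\mathcal W}\|G\|\le M$), with the Euclidean norm. A stochastic variational inequality instance consists of a compact convex domain $\mathcal W\subseteq\mathbb R^d$, operators $F_\beta\in\mathcal M^1_{\mathcal W}(L,M)$, $\beta\in\mathcal Z$, and a distribution $\mathcal P$ on $\mathcal Z$; $F=\mathbb E_{\beta\sim\mathcal P}[F_\beta]$. An algorithm $\mathcal A$ maps a data set $\mathbf S\sim\mathcal P^n$ to $\mathcal A(\mathbf S)\in\mathcal W$; its weak VI gap is $\mathrm{WeakGap}_{\mathrm{VI}}(\mathcal A,F)=\mathbb E_{\mathcal A}\sup_{w\in\mathcal W}\mathbb E_{\mathbf S}[\langle F(w),\mathcal A(\mathbf S)-w\rangle]$, with $\mathbb E_{\mathcal A}$ over the internal randomness. $\mathcal A$ is $(\varepsilon,\delta)$-differentially private if $\mathbb P_{\mathcal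 A}[\mathcal A(\mathbf S)\in E]\le e^{\varepsilon}\mathbb P_{\mathcal A}[\mathcal A(\mathbf S')\in E]+\delta$ for all events $E$ and all $\mathbf S,\mathbf S'\in\mathcal Z^n$ differing in at most one entry. That the class satisfies a lower bound $\widetilde\Omega(g)$ means: every $(\varepsilon,\delta)$-differentially private algorithm has weak VI gap at least $c\,g$ on some instance of the class, where $c>0$ is an absolute constant up to factors polylogarithmic in $1/\delta$ (and the other parameters), which $\widetilde\Omega$ hides. *)

(* Defs.v *)
From HB Require Import structures.
From mathcomp Require Import all_boot all_order all_algebra.
From mathcomp Require Import all_classical all_reals all_analysis.

Set Implicit Arguments.
Unset Strict Implicit.
Unset Printing Implicit Defensive.

Import Order.TTheory GRing.Theory Num.Theory.
Import numFieldNormedType.Exports.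

Local Open Scope classical_set_scope.
Local Open Scope ring_scope.

Section euclidean.
Context {R : realType} {d : nat}.
Implicit Types u v : 'rV[R]_d.

Definition dotp u v : R := \sum_(j < d) u 0 j * v 0 j.

(* The norm `|u| of the library on 'rV[R]_d is the max norm. *)
Definition enorm u : R := Num.sqrt (dotp u u).

Definition eball (x : 'rV[R]_d) (r : R) : set 'rV[R]_d :=
  [set u | enorm (u - x) <= r].

Definition borel_rV : set (set 'rV[R]_d) := <<s [set U : set 'rV[R]_d | open U] >>.

Definition monotone_lip_bounded (W : set 'rV[R]_d) (L M : R)
    (G : 'rV[R]_d -> 'rV[R]_d) : Prop :=
  [/\ (forall u v, W u -> W v -> 0 <= dotp (G u - G v) (u - v)),
      (forall u v, W u -> W v -> enorm (G u - G v) <= L * enorm (u - v)) &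
      (forall u, W u -> enorm (G u) <= M)].

End euclidean.

Section iid_sample.
Context {dZ : measure_display} {Z : measurableType dZ} {R : realType}.

Definition tuple_cons n (x : Z * n.-tuple Z) : n.+1.-tuple Z :=
  [tuple of x.1 :: x.2].

Lemma measurable_tuple_cons n : measurable_fun setT (@tuple_cons n).
Proof. exact: (measurable_cons measurable_fst measurable_snd). Qed.

HB.instance Definition _ n :=
  isMeasurableFun.Build _ _ _ _ (@tuple_cons n) (@measurable_tuple_cons n).

(* The n-fold product of P, by recursion on binary products. *)
Fixpoint iid (P : probability Z R) (n : nat) : probability (n.-tuple Z) R :=
  if n is m.+1 then distribution (P \x iid P m)%E (@tuple_cons m)
  else \d_ [tuple].

Lemma iid_rectangle (P : probability Z R) n (B : 'I_n -> set Z) :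
  (forall i, measurable (B i)) ->
  iid P n [set s | forall i, B i (tnth s i)] = (\prod_(i < n) P (B i))%E.
Proof.
elim: n B => [|n IH] B mB.
  rewrite big_ord0 /= diracE (_ : [set s | _] = setT) ?in_setT//.
  by apply/seteqP; split=> [//|s _ []].
rewrite big_ord_recl /= /distribution /pushforward.
have mBl : measurable
    [set s : n.-tuple Z | forall i, B (lift ord0 i) (tnth s i)].
  rewrite (_ : [set s | _] = \big[setI/setT]_(i < n)
      ((@tnth n Z ^~ i) @^-1` B (lift ord0 i))).
    elim/big_ind : _ => [|X Y|i _]; [exact: measurableT|exact: measurableI|].
    by rewrite -[X in measurable X]setTI; exact: measurable_tnth.
  rewrite -bigcap_seq; apply/seteqP; split=> [s h i _|s h i]; first exact: h.
  by apply: h => /=; rewrite mem_index_enum.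
rewrite (_ : _ @^-1` _ =
    B ord0 `*` [set s : n.-tuple Z | forall i, B (lift ord0 i) (tnth s i)]).
  by rewrite product_measure1E//; congr (_ * _)%E; exact: IH.
apply/seteqP; split=> [[z s] /= h|[z s] /= [h0 h] i].
  split; first by have := h ord0; rewrite tnth0.
  by move=> i; have := h (lift ord0 i); rewrite tnthS.
by have [j ->|->] := unliftP ord0 i; rewrite ?tnthS ?tnth0.
Qed.

End iid_sample.

Section dp_svi.
Context {R : realType} {d : nat}.
Local Notation V := 'rV[R]_d.

Definition mean_operator {dZ} {Z : measurableType dZ} (P : probability Z R)
    (F : Z -> V -> V) : V -> V :=
  fun w => \row_(j < d) \int[P]_z F z w 0 j.

Definition svi_operators {dZ} {Z : measurableType dZ} (W : set V) (L M : R)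
    (F : Z -> V -> V) : Prop :=
  (forall z, monotone_lip_bounded W L M (F z)) /\
  (forall w j, W w -> measurable_fun setT (fun z => F z w 0 j)).

(* The internal randomness is an explicit seed in [O], independent of the
   sample: in the weak gap the supremum over w is taken at a fixed seed. *)
Definition algorithm {dO dZ} {O : measurableType dO} {Z : measurableType dZ}
    (W : set V) n (A : O -> n.-tuple Z -> V) : Prop :=
  (forall o s, W (A o s)) /\
  (forall E, borel_rV E -> measurable [set x : O * n.-tuple Z | E (A x.1 x.2)]).

Definition neighbours {Z : Type} n (s s' : n.-tuple Z) : Prop :=
  exists i : 'I_n, forall j, j != i -> tnth s j = tnth s' j.

Definition diff_private {dO} {O : measurableType dO} {Z : Type}
    (Q : probability O R) (eps delta : R) n (A : O -> n.-tuple Z -> V) : Prop :=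
  forall s s', neighbours s s' -> forall E, borel_rV E ->
    (Q [set o | E (A o s)] <=
      (expR eps)%:E * Q [set o | E (A o s')] + delta%:E)%E.

Definition weak_gap {dO dZ} {O : measurableType dO} {Z : measurableType dZ}
    (W : set V) (Q : probability O R) (P : probability Z R) n
    (A : O -> n.-tuple Z -> V) (G : V -> V) : \bar R :=
  (\int[Q]_o ereal_sup
     [set (\int[iid P n]_s dotp (G w) (A o s - w))%R%:E | w in W])%E.

(* The data space and the operators are public: they are fixed before the
   algorithm, and only the data distribution is chosen against it. *)
Definition dp_svi_lower_bound (W : set V) n (L M eps delta g : R) : Prop :=
  exists (dZ : measure_display) (Z : measurableType dZ) (F : Z -> V -> V),
    svi_operators W L M F /\
    forall (dO : measure_display) (O : measurableType dO)
      (Q : probability O R) (A : O -> n.-tuple Z -> V),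
      algorithm W A -> diff_private Q eps delta A ->
      exists P : probability Z R,
        (g%:E <= weak_gap W Q P A (mean_operator P F))%E.

End dp_svi.

(* The base of the polylogarithmic factors hidden by a soft-Omega; it is at
   least 1, and omits the dimensional parameters L, M and D. *)
Definition log_factor {R : realType} (n d : nat) (eps delta : R) : R :=
  ln (3 + n%:R + d%:R + eps + eps^-1 + delta^-1).

(* Main.v *)
Require Import Defs.
From HB Require Import structures.
From mathcomp Require Import all_boot all_order all_algebra.
From mathcomp Require Import all_classical all_reals all_analysis.
From mathcomp Require Import measurable_realfun measurable_fun_approximation.
From mathcomp Require Import ring lra.

Import Order.TTheory GRing.Theory Num.Theory.
Import numFieldNormedType.Exports.

Local Open Scope classical_set_scope.
Local Open Scope ring_scope.

Set Implicit Arguments.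
Unset Strict Implicit.
Unset Printing Implicit Defensive.

(** The hard instances are linear: a data point is a vector [z] of [d] signs, its
    operator is the constant [- (M / sqrt d) *: z], and under the distribution
    with mean [p] the weak gap equals, up to the factor [M / sqrt d], the largest
    value of [<p, w - x0>] over the domain minus the expected value of
    [<p, A(S) - x0>]. Since the domain contains the ball of centre [x0] and radius
    [D / 4], the first term is at least [D / (4 * sqrt d)] times the sum of the
    [`|p_j|] ([weak_gap_ge], [weak_gap_of_correlation]). It remains to find [p]
    for which the output correlates little with [p].

    This is a fingerprinting argument. Let the coordinates of [p] be independent
    and uniform on [-a, a], and weight the logarithmic derivative of the
    likelihood of a sign by [(a ^+ 2 - p_j ^+ 2)]; call the result the score. An
    integration by parts in [p_j], without boundary terms because the weight
    vanishes at both ends, shows that on average over [p] the correlation of any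
    statistic with the sum of the [n] scores is twice its correlation with [p]
    ([grid_prior], [score_identity]). An output close to optimal would have a
    correlation with [p] of the order of [D * sqrt d * a], hence would be as
    correlated with the scores. But the correlation with the scores is small, of
    the order of [a ^+ 2], for two independent reasons.

    - The scores are independent and centred, so that their sum has a length of
      the order of [a ^+ 2 * sqrt (n * d)] ([correlation_le_variance]).
    - If the algorithm is private, replacing one data point by a fresh copy makes
      its score independent of the output and changes little else: the
      correlation with one score is at most of the order of
      [a ^+ 2 * D * (eps + delta * sqrt d)] ([resampled_score_le],
      [correlation_le_resampled]). For small [eps] one compares the positive and
      negative parts of the correlation; for large [eps] one uses that the
      correlation with a fresh score is sub-Gaussian ([score_row_mgf]), so that
      only the part exceeding a multiple of [eps] matters.

    Choosing [a] a small multiple of the larger of [1 / sqrt n] and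
    [min 1 (sqrt d / (eps * n))] contradicts near-optimality, and the gap is at
    least a multiple of [M * D * a]. The constant depends on [kappa] only, because
    the output lies within distance [kappa * D] of [x0], and no logarithmic factor
    is lost. To keep every average a finite sum, the uniform law is replaced by a
    fine grid, the error of the Riemann sums being negligible. *)

(** * Finite product distributions *)

Section product_expectation.
Context {R : realFieldType} {T : finType} {n : nat}.
Variable q : 'I_n -> T -> R.
Implicit Types (G H : n.-tuple T -> R) (s : n.-tuple T).

Definition prodE G : R := \sum_s (\prod_i q i (tnth s i)) * G s.

Definition replace s (i : 'I_n) (z : T) : n.-tuple T :=
  [tuple (if j == i then z else tnth s j) | j < n].

Lemma tnth_replace s i z j :
  tnth (replace s i z) j = if j == i then z else tnth s j.
Proof. by rewrite tnth_mktuple. Qed.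

Lemma prodED G H : prodE (fun s => G s + H s) = prodE G + prodE H.
Proof. by rewrite /prodE -big_split; apply: eq_bigr => s _; rewrite mulrDr. Qed.

Lemma prodEZ (c : R) G : prodE (fun s => c * G s) = c * prodE G.
Proof. by rewrite /prodE mulr_sumr; apply: eq_bigr => s _; rewrite mulrCA. Qed.

Lemma prodE_sum (I : finType) (G : I -> n.-tuple T -> R) :
  prodE (fun s => \sum_i G i s) = \sum_i prodE (G i).
Proof.
rewrite /prodE exchange_big; apply: eq_bigr => s _.
by rewrite -mulr_sumr.
Qed.

Lemma eq_prodE G H : G =1 H -> prodE G = prodE H.
Proof. by move=> GH; apply: eq_bigr => s _; rewrite GH. Qed.

Lemma sum_tuple_prod (h : 'I_n -> T -> R) :
  \sum_(s : n.-tuple T) \prod_i h i (tnth s i) = \prod_i \sum_x h i x.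
Proof.
rewrite bigA_distr_bigA /=.
rewrite (reindex (fun s : n.-tuple T => [ffun i => tnth s i])) /=.
  by apply: eq_bigr => s _; apply: eq_bigr => i _; rewrite ffunE.
exists (fun f : {ffun 'I_n -> T} => [tuple f i | i < n]) => [s _|f _].
  by apply: eq_from_tnth => i; rewrite tnth_mktuple ffunE.
by apply/ffunP => i; rewrite ffunE tnth_mktuple.
Qed.

Lemma prodE_prod (h : 'I_n -> T -> R) :
  prodE (fun s => \prod_i h i (tnth s i)) = \prod_i \sum_x q i x * h i x.
Proof.
rewrite -sum_tuple_prod; apply: eq_bigr => s _.
by rewrite -big_split.
Qed.

Hypothesis q_ge0 : forall i x, 0 <= q i x.
Hypothesis q_sum1 : forall i, \sum_x q i x = 1.

Lemma prodE_cst (c : R) : prodE (fun=> c) = c.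
Proof.
rewrite /prodE -mulr_suml sum_tuple_prod big1 ?mul1r// => i _.
Qed.

Lemma prodE_le G H : (forall s, G s <= H s) -> prodE G <= prodE H.
Proof.
by move=> GH; apply: ler_sum => s _; rewrite ler_wpM2l// prodr_ge0.
Qed.

Lemma exists_ge_prodE G : exists s, prodE G <= G s.
Proof.
have [s0 _|no_s] := pickP (fun _ : n.-tuple T => true).
  exists [arg max_(s > s0) G s]%O; case: Order.TotalTheory.arg_maxP => // s _ maxs.
  by rewrite -[leRHS]prodE_cst; apply: prodE_le => t; exact: maxs.
have := prodE_cst 1; rewrite /prodE big1 => [/eqP|s _]; last by have := no_s s.
by rewrite eq_sym oner_eq0.
Qed.

(** Swapping the entry at [i] with an independent fresh draw is a
    weight-preserving involution of the pairs (sample, fresh draw). *)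
Lemma prodE_resample (i : 'I_n) G :
  prodE G = prodE (fun s => \sum_z q i z * G (replace s i z)).
Proof.
pose sw (x : n.-tuple T * T) := (replace x.1 i x.2, tnth x.1 i).
have swK : involutive sw.
  move=> [s z]; rewrite /sw /= tnth_replace eqxx; congr pair.
  apply: eq_from_tnth => j; rewrite !tnth_replace.
  by case: eqP => [->|].
transitivity (\sum_(x : n.-tuple T * T)
    (\prod_j q j (tnth x.1 j)) * q i x.2 * G x.1).
  rewrite -(pair_bigA _ (fun s z => (\prod_j q j (tnth s j)) * q i z * G s)) /=.
  apply: eq_bigr => s _; rewrite -mulr_suml -mulr_sumr q_sum1 mulr1//.
rewrite (reindex_inj (inv_inj swK)) /=.
rewrite /prodE; under [RHS]eq_bigr do rewrite mulr_sumr.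
rewrite pair_bigA /=; apply: eq_bigr => -[s z] _ /=.
rewrite mulrA; congr (_ * _).
rewrite (bigD1 i)//= [in RHS](bigD1 i)//= tnth_replace eqxx.
under eq_bigr => j ji do rewrite tnth_replace (negPf ji).
by rewrite -!mulrA mulrC -mulrA [in RHS]mulrA mulrC -!mulrA; congr (_ * _); rewrite mulrC.
Qed.

Lemma prodE_marginal (i : 'I_n) (h : T -> R) :
  prodE (fun s => h (tnth s i)) = \sum_z q i z * h z.
Proof.
rewrite (prodE_resample i) -[RHS]prodE_cst; apply: eq_prodE => s.
by apply: eq_bigr => z _; rewrite tnth_replace eqxx.
Qed.

(** Independent centred variables are orthogonal: resampling the entry [i] kills
    every product of [h (tnth s i)] with a function of the other entries. *)
Lemma prodE_sqr_sum (h : T -> R) (b : R) :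
  (forall i, \sum_z q i z * h z = 0) -> (forall z, `|h z| <= b) ->
  prodE (fun s => (\sum_i h (tnth s i)) ^+ 2) <= n%:R * b ^+ 2.
Proof.
move=> h0 hb.
have -> : prodE (fun s => (\sum_i h (tnth s i)) ^+ 2) =
    \sum_i prodE (fun s => h (tnth s i) ^+ 2).
  under eq_prodE do rewrite expr2 mulr_suml.
  rewrite prodE_sum; apply: eq_bigr => i _.
  rewrite (prodE_resample i) [RHS](prodE_resample i).
  apply: eq_prodE => s.
  under eq_bigr => z _.
    rewrite (bigD1 i)//= !tnth_replace eqxx.
    under eq_bigr => j ji do rewrite tnth_replace (negPf ji).
    rewrite mulrDr -expr2 mulrDr; over.
  rewrite big_split /= [X in _ + X](_ : _ = 0) ?addr0.
    by apply: eq_bigr => z _; rewrite tnth_replace eqxx.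
  by under eq_bigr do rewrite mulrA; rewrite -mulr_suml h0 mul0r.
rewrite mulr_natl -[X in _ *+ X]card_ord -sumr_const; apply: ler_sum => i _.
rewrite -[leRHS]prodE_cst; apply: prodE_le => s.
by rewrite -real_normK ?num_real// lerXn2r ?nnegrE// (le_trans _ (hb (tnth s i))).
Qed.

End product_expectation.

(** * A discrete prior for the mean of a sign *)

Section riemann_sum.
Context {R : realType}.
Implicit Types (p : {poly R}) (a u h : R).

Lemma poly_lipschitz p : exists2 C : R, 0 <= C & forall u h,
  `|u| <= 1 -> `|u + h| <= 1 -> `|p.[u + h] - p.[u]| <= C * `|h|.
Proof.
elim/poly_ind: p => [|p c [C C0 IH]].
  by exists 0 => // u h _ _; rewrite !horner0 subrr normr0 mul0r.
exists (C + `|p.[0]| + C) => [|u h u1 uh1]; first by rewrite !addr_ge0.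
rewrite !hornerE.
have -> : p.[u + h] * (u + h) + c - (p.[u] * u + c) =
    (p.[u + h] - p.[u]) * (u + h) + p.[u] * h by ring.
have pu : `|p.[u]| <= C + `|p.[0]|.
  have := IH 0 u; rewrite normr0 add0r => /(_ ler01 u1) pu0.
  have -> : p.[u] = p.[u] - p.[0] + p.[0] by ring.
  apply: le_trans (ler_normD _ _) _; rewrite lerD2r; apply: le_trans pu0 _.
  by rewrite ler_piMr.
apply: le_trans (ler_normD _ _) _; rewrite !normrM.
have -> : (C + `|p.[0]| + C) * `|h| = C * `|h| + (C + `|p.[0]|) * `|h| by ring.
apply: lerD; last by rewrite ler_wpM2r.
by apply: le_trans (IH u h u1 uh1); rewrite ler_piMr.
Qed.

(** First-order Taylor expansion with a uniform quadratic remainder. It is proved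
    by induction on the coefficients, the Lipschitz bound absorbing the
    cross term of the product rule. *)
Lemma poly_taylor p : exists2 C : R, 0 <= C & forall u h,
  `|u| <= 1 -> `|u + h| <= 1 ->
  `|p.[u + h] - p.[u] - h * p^`().[u]| <= C * h ^+ 2.
Proof.
elim/poly_ind: p => [|p c [C C0 IH]].
  by exists 0 => // u h _ _; rewrite deriv0 !horner0 mulr0 !subrr normr0 mul0r.
have [C' C'0 lip] := poly_lipschitz p.
exists (C + C') => [|u h u1 uh1]; first by rewrite !addr_ge0.
rewrite derivD derivM derivX derivC; set rhs := leRHS; rewrite !hornerE {}/rhs.
have -> : p.[u + h] * (u + h) + c - (p.[u] * u + c) -
      h * (p^`().[u] * u + p.[u]) =
    (p.[u + h] - p.[u] - h * p^`().[u]) * u + (p.[u + h] - p.[u]) * h by ring.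
have -> : (C + C') * h ^+ 2 = C * h ^+ 2 + C' * `|h| * `|h|.
  by rewrite -mulrA -expr2 real_normK ?num_real// mulrDl.
apply: le_trans (ler_normD _ _) _; apply: lerD; rewrite normrM.
  by apply: le_trans (IH u h u1 uh1); rewrite ler_piMr.
by rewrite ler_wpM2r//; exact: lip.
Qed.

Definition grid a (m i : nat) : R := - a + 2 * a / m%:R * i%:R.

Lemma grid_bound a m i : 0 <= a -> (i <= m)%N -> `|grid a m i| <= a.
Proof.
move=> a0 im; rewrite ler_norml /grid.
have : 0 <= 2 * a / m%:R * i%:R <= 2 * a.
  rewrite -mulrA; have -> : 0 <= 2 * a * (m%:R^-1 * i%:R) :> R.
    by rewrite !mulr_ge0// invr_ge0.
  case: m im => [|m] im; first by rewrite invr0 mul0r mulr0 mulr_ge0.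
  by rewrite ler_piMr ?mulr_ge0// mulrC ler_pdivrMr ?ltr0n// mul1r ler_nat.
by move=> /andP[? ?]; apply/andP; split; lra.
Qed.

(** On each cell of the grid the Taylor remainder is quadratic in the mesh, and
    the increments of [p] telescope; the error is thus of the order of the mesh. *)
Lemma riemann_sum_deriv p a : 0 < a <= 1 -> exists2 C : R, 0 <= C &
  forall m, `| \sum_(i < m.+1) m.+1%:R^-1 * p^`().[grid a m.+1 i]
               - (p.[a] - p.[- a]) / (2 * a)| <= C / m.+1%:R.
Proof.
move=> /andP[a0 a1]; have [C C0 taylor] := poly_taylor p.
exists (C * (2 * a)) => [|m]; first by rewrite !mulr_ge0// ltW.
set M := m.+1%:R; have M0 : 0 < M by rewrite ltr0n.
pose h := 2 * a / M; have h0 : 0 < h by rewrite divr_gt0// mulr_gt0.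
have gridS i : grid a m.+1 i.+1 = grid a m.+1 i + h.
  by rewrite /grid -/M -/h -natr1 mulrDr mulr1 addrA.
have -> : (p.[a] - p.[- a]) =
    \sum_(i < m.+1) (p.[grid a m.+1 i + h] - p.[grid a m.+1 i]).
  under eq_bigr do rewrite -gridS.
  rewrite -(big_mkord xpredT (fun i => p.[grid a m.+1 i.+1] - p.[grid a m.+1 i])).
  rewrite (telescope_sumr (fun i => p.[grid a m.+1 i]))//.
  have -> : grid a m.+1 0 = - a by rewrite /grid mulr0 addr0.
  have -> // : grid a m.+1 m.+1 = a.
  by rewrite /grid -/M mulfVK ?gt_eqF//; ring.
rewrite mulr_suml -sumrB; apply: le_trans (ler_norm_sum _ _ _) _.
have -> : C * (2 * a) / M = \sum_(i < m.+1) (C * h / M).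
  by rewrite sumr_const card_ord -[RHS]mulr_natr -/M /h; field; rewrite gt_eqF.
apply: ler_sum => i _.
have bnd k : (k <= m.+1)%N -> `|grid a m.+1 k| <= 1.
  by move=> km; apply: le_trans (grid_bound _ km) _ => //; exact: ltW.
have := taylor (grid a m.+1 i) h (bnd _ (ltnW (ltn_ord i))).
rewrite -gridS => /(_ (bnd _ (ltn_ord i))); rewrite gridS.
set E := _ - _ - _ => Eh.
have -> : M^-1 * p^`().[grid a m.+1 i] -
    (p.[grid a m.+1 i + h] - p.[grid a m.+1 i]) / (2 * a) = - (E / (2 * a)).
  by rewrite /E /h; field; rewrite !gt_eqF.
rewrite normrN normrM normfV [`|2 * a|]gtr0_norm ?mulr_gt0//.
rewrite ler_pdivrMr ?mulr_gt0//; apply: le_trans Eh _.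
by rewrite le_eqVlt; apply/orP; left; apply/eqP; rewrite /h; field; rewrite gt_eqF.
Qed.

End riemann_sum.

Section sign_prior.
Context {R : realType}.
Implicit Types (a u : R) (b : bool).

Definition spin b : R := if b then 1 else -1.

Definition bern u b : R := (1 + u * spin b) / 2.

(** [(a ^+ 2 - u ^+ 2)] times the logarithmic derivative of [bern u b] in [u].
    The factor vanishes at the ends of the range of the prior, which kills the
    boundary terms of the integration by parts. *)
Definition score a u b : R := (a ^+ 2 - u ^+ 2) * (spin b / (1 + u * spin b)).

Lemma bern_ge0 u b : `|u| <= 1 -> 0 <= bern u b.
Proof. by rewrite ler_norml /bern /spin => /andP[? ?]; case: b; lra. Qed.

Lemma bern_le1 u b : `|u| <= 1 -> bern u b <= 1.
Proof. by rewrite ler_norml /bern /spin => /andP[? ?]; case: b; lra. Qed.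

Lemma sum_bool (f : bool -> R) : \sum_b f b = f true + f false.
Proof. by rewrite big_bool. Qed.

Lemma bern_sum1 u : \sum_b bern u b = 1.
Proof. by rewrite sum_bool /bern /spin; lra. Qed.

Lemma bern_mean u : \sum_b bern u b * spin b = u.
Proof. by rewrite sum_bool /bern /spin; lra. Qed.

Lemma spin_denom_gt0 u b : `|u| <= 1 / 2 -> 1 / 2 <= 1 + u * spin b.
Proof. by rewrite ler_norml /spin => /andP[? ?]; case: b; lra. Qed.

Lemma score_mean a u : `|u| <= 1 / 2 -> \sum_b bern u b * score a u b = 0.
Proof.
rewrite sum_bool => u2.
have := spin_denom_gt0 true u2; have := spin_denom_gt0 false u2.
by rewrite /bern /score /spin => ? ?; field; apply/andP; split; rewrite gt_eqF//; lra.
Qed.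

Lemma score_bound a u b : `|u| <= a -> a <= 1 / 2 -> `|score a u b| <= 2 * a ^+ 2.
Proof.
move=> ua a2; have u2 := spin_denom_gt0 b (le_trans ua a2).
have a0 : 0 <= a by apply: le_trans ua.
have uu : 0 <= a ^+ 2 - u ^+ 2 <= a ^+ 2.
  rewrite subr_ge0 -[X in X <= _]real_normK ?num_real// lerXn2r ?nnegrE//=.
  by rewrite lerBlDr lerDl sqr_ge0.
move: uu => /andP[uu0 uu1].
rewrite /score normrM ger0_norm// mulrC ler_pM//.
rewrite normrM normfV [`|1 + _|]gtr0_norm; last by apply: lt_le_trans u2; lra.
have -> : `|spin b| = 1 by rewrite /spin; case: b {u2}; rewrite ?normrN normr1.
rewrite mul1r -[leRHS]invrK lef_pV2 ?posrE ?invr_gt0//; first by lra.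
by apply: lt_le_trans u2; lra.
Qed.

Let lik_poly (s : seq bool) : {poly R} :=
  \prod_(b <- s) ((2^-1)%:P * (1%:P + (spin b)%:P * 'X)).

Let lik_polyE s u : (lik_poly s).[u] = \prod_(b <- s) bern u b.
Proof.
rewrite /lik_poly horner_prod; apply: eq_bigr => b _.
by rewrite !hornerE /bern; ring.
Qed.

Let deriv_lik_poly s u : `|u| <= 1 / 2 ->
  (lik_poly s)^`().[u] =
  (\prod_(b <- s) bern u b) * \sum_(b <- s) (spin b / (1 + u * spin b)).
Proof.
move=> u2; elim: s => [|b s IH].
  by rewrite /lik_poly !big_nil derivC horner0 mulr0.
rewrite /lik_poly !big_cons -/(lik_poly s) derivM hornerD !hornerM IH lik_polyE.
have -> : ((2^-1)%:P * (1%:P + (spin b)%:P * 'X))^`() = (2^-1 * spin b)%:P.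
  rewrite derivM derivC mul0r add0r derivD derivC derivM derivC derivX.
  by rewrite mul0r !add0r mulr1 polyCM.
rewrite !(hornerD, hornerM, hornerC, hornerX) /bern.
have := spin_denom_gt0 b u2; set D := 1 + u * spin b => D0.
have -> : 1 + spin b * u = D by rewrite mulrC.
by field; rewrite gt_eqF//; lra.
Qed.

(** Integration by parts against the uniform law on [-a, a]: the first sum
    approximates the integral of the derivative of
    [(a ^+ 2 - u ^+ 2) * \prod_l bern u b_l], which vanishes at both ends.
    A finite grid replaces the interval so that all averages are finite sums. *)
Lemma grid_prior a (eta : R) n : 0 < a <= 1 / 2 -> 0 < eta ->
  exists (m : nat) (u : 'I_m.+1 -> R),
  [/\ (forall i, `|u i| <= a),
      (forall b : n.-tuple bool,
        `| \sum_i m.+1%:R^-1 * (\prod_l bern (u i) (tnth b l) *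
             (\sum_l score a (u i) (tnth b l) - 2 * u i)) | <= eta) &
      a / 4 <= \sum_i m.+1%:R^-1 * `|u i|].
Proof.
move=> /andP[a0 a2] eta0.
pose T (b : n.-tuple bool) : {poly R} := ((a ^+ 2)%:P - 'X ^+ 2) * lik_poly b.
have a1 : 0 < a <= 1 by apply/andP; split=> //; lra.
have /choice[C CP] : forall b : n.-tuple bool, exists C : R, 0 <= C /\ forall m,
    `| \sum_(i < m.+1) m.+1%:R^-1 * (T b)^`().[grid a m.+1 i]
       - ((T b).[a] - (T b).[- a]) / (2 * a)| <= C / m.+1%:R.
  by move=> b; have [C C0 CP] := riemann_sum_deriv (T b) a1; exists C.
have [C3 C30 C3P] := riemann_sum_deriv ('X^3 : {poly R}) a1.
pose K := C3 / a ^+ 2 * 4 + \sum_b C b / eta.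
have K1 : 0 <= C3 / a ^+ 2 * 4.
  by rewrite mulr_ge0// divr_ge0// exprn_ge0// ltW.
have K2 : forall b : n.-tuple bool, 0 <= C b / eta.
  by move=> b; rewrite divr_ge0 ?(proj1 (CP b))// ltW.
have [m Km] : exists m, K <= m.+1%:R.
  exists (Num.truncn K); apply: ltW; exact: truncnS_gt.
have m0 : 0 < m.+1%:R :> R by rewrite ltr0n.
have ua i : (i <= m.+1)%N -> `|grid a m.+1 i| <= a.
  by apply: grid_bound; exact: ltW.
exists m, (fun i => grid a m.+1 i); split => [i|b|].
- by apply: ua; apply: ltnW.
- have := (CP b).2 m.
  have -> : (T b).[a] = 0 by rewrite /T !hornerE; ring.
  have -> : (T b).[- a] = 0 by rewrite /T !hornerE; ring.
  rewrite subrr mul0r subr0 => Tm.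
  rewrite (eq_bigr (fun i : 'I_m.+1 => m.+1%:R^-1 * (T b)^`().[grid a m.+1 i])).
    apply: le_trans Tm _; rewrite ler_pdivrMr// mulrC -ler_pdivrMr//.
    apply: le_trans Km; rewrite /K (bigD1 b)//= addrCA lerDl addr_ge0//.
    by rewrite sumr_ge0.
  move=> i _; congr (_ * _).
  have u2 : `|grid a m.+1 i| <= 1 / 2.
    by apply: le_trans (ua _ (ltnW (ltn_ord i))) a2.
  rewrite /T derivM hornerD !hornerM deriv_lik_poly// lik_polyE.
  rewrite !big_tuple derivB derivC derivXn sub0r !(hornerD, hornerN, hornerM, hornerC, hornerX, hornerXn, hornerMn) /score -mulr_sumr.
  by ring.
  (* The mean of [u ^+ 2] is about [a ^+ 2 / 3], by the Riemann sum of the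
     derivative of ['X^3], and [`|u|] is at least [u ^+ 2 / a]. *)
- have := C3P m; rewrite ler_distl => /andP[+ _].
  have -> : ('X^3).[a] - ('X^3).[- a] = 2 * a ^+ 3 by rewrite !hornerXn; ring.
  have -> : 2 * a ^+ 3 / (2 * a) = a ^+ 2 by field; rewrite gt_eqF.
  have mC : C3 / m.+1%:R <= a ^+ 2 / 4.
    rewrite ler_pdivrMr// mulrC -ler_pdivrMr ?divr_gt0 ?exprn_gt0//.
    apply: le_trans Km; rewrite /K -[leLHS]addr0; apply: lerD.
      by rewrite le_eqVlt; apply/orP; left; apply/eqP; field; rewrite gt_eqF.
    by rewrite sumr_ge0.
  move=> lb.
  have : a ^+ 2 - a ^+ 2 / 4 <= 3 * a * \sum_(i < m.+1) m.+1%:R^-1 * `|grid a m.+1 i|.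
    apply: le_trans (le_trans _ lb) _; first by rewrite lerD2l lerN2.
    rewrite mulr_sumr; apply: ler_sum => i _.
    rewrite mulrCA ler_wpM2l ?invr_ge0// derivXn hornerMn hornerXn.
    rewrite -[X in X *+ _]real_normK ?num_real// -mulr_natl -mulrA ler_wpM2l//.
    by rewrite expr2 ler_wpM2r//; apply: ua; apply: ltnW.
  move=> lbs; rewrite -(ler_pM2l (_ : 0 < 3 * a)) ?mulr_gt0//.
  by have -> : 3 * a * (a / 4) = a ^+ 2 - a ^+ 2 / 4 by field.
Qed.

End sign_prior.

(** * The Bayes identity *)

Section score_identity.
Context {R : realType} {d n : nat}.
Implicit Types (p : 'I_d -> R) (z : d.-tuple bool) (s : n.-tuple (d.-tuple bool)).

Definition signs_law p z : R := \prod_j bern (p j) (tnth z j).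

Lemma signs_law_ge0 p z : (forall j, `|p j| <= 1) -> 0 <= signs_law p z.
Proof. by move=> p1; apply: prodr_ge0 => j _; exact: bern_ge0. Qed.

Lemma signs_law_sum1 p : \sum_z signs_law p z = 1.
Proof.
by rewrite (sum_tuple_prod (fun j => bern (p j))) big1// => j _; exact: bern_sum1.
Qed.

Definition sampleE p (G : n.-tuple (d.-tuple bool) -> R) : R :=
  prodE (fun=> signs_law p) G.

(** Bayes identity: for [p] drawn from the prior, the conditional mean of the
    sum of the scores of the sample equals twice that of [p], up to the error of
    the grid, so that no statistic of the sample can tell them apart. Only the coordinate [j] of the
    prior matters for the [j]-th summand; the others integrate to at most 1. *)
Lemma score_identity (a B eta : R) (m : nat) (u : 'I_m.+1 -> R)
    (v : n.-tuple (d.-tuple bool) -> 'I_d -> R) :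
  (forall i, `|u i| <= 1) -> 0 <= B -> 0 <= eta ->
  (forall b : n.-tuple bool,
     `| \sum_i m.+1%:R^-1 * (\prod_l bern (u i) (tnth b l) *
          (\sum_l score a (u i) (tnth b l) - 2 * u i)) | <= eta) ->
  (forall s j, `|v s j| <= B) ->
  `| prodE (fun _ _ => m.+1%:R^-1) (fun t : d.-tuple 'I_m.+1 =>
       sampleE (fun j => u (tnth t j)) (fun s => \sum_j
         (\sum_i score a (u (tnth t j)) (tnth (tnth s i) j)
           - 2 * u (tnth t j)) * v s j)) |
    <= (#|{: n.-tuple (d.-tuple bool)}| * d)%:R * (B * eta).
Proof.
move=> u1 B0 eta0 prior vB.
pose h s (j : 'I_d) (j' : 'I_d) (i : 'I_m.+1) : R :=
  m.+1%:R^-1 * ((\prod_l bern (u i) (tnth (tnth s l) j')) *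
    (if j' == j then \sum_l score a (u i) (tnth (tnth s l) j) - 2 * u i else 1)).
have -> : prodE (fun _ _ => m.+1%:R^-1) (fun t : d.-tuple 'I_m.+1 =>
       sampleE (fun j => u (tnth t j)) (fun s => \sum_j
         (\sum_i score a (u (tnth t j)) (tnth (tnth s i) j)
           - 2 * u (tnth t j)) * v s j)) =
    \sum_s \sum_j v s j * \prod_j' \sum_i h s j j' i.
  rewrite /prodE /sampleE /prodE /=; under eq_bigr do rewrite mulr_sumr.
  rewrite exchange_big; apply: eq_bigr => s _ /=.
  under [RHS]eq_bigr do rewrite -(sum_tuple_prod (h s _)) mulr_sumr.
  rewrite [RHS]exchange_big; apply: eq_bigr => t _ /=.
  rewrite mulrA mulr_sumr; apply: eq_bigr => j _.
  suff -> : \prod_j' h s j j' (tnth t j') = \prod_(j' < d) m.+1%:R^-1 *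
      (\prod_l signs_law (fun j0 => u (tnth t j0)) (tnth s l) *
       (\sum_l score a (u (tnth t j)) (tnth (tnth s l) j) - 2 * u (tnth t j))).
    by ring.
  rewrite /signs_law exchange_big /h !big_split /=; congr (_ * (_ * _)).
  by rewrite (bigD1 j)//= eqxx [X in _ * X]big1 ?mulr1// => j' /negPf ->.
apply: le_trans (ler_norm_sum _ _ _) _.
rewrite mulr_natl mulnC mulrnA -sumr_const; apply: ler_sum => s _.
apply: le_trans (ler_norm_sum _ _ _) _.
rewrite -[X in _ *+ X]card_ord -sumr_const; apply: ler_sum => j _.
rewrite normrM ler_pM// (bigD1 j)//= normrM -[leRHS]mulr1 ler_pM//.
  rewrite (eq_bigr (fun i => m.+1%:R^-1 * (\prod_l bern (u i)
      (tnth [tuple tnth (tnth s l) j | l < n] l) *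
      (\sum_l score a (u i) (tnth [tuple tnth (tnth s l) j | l < n] l)
        - 2 * u i)))) => [|i _].
    exact: prior.
  rewrite /h eqxx; congr (_ * (_ * (_ - _))).
    by apply: eq_bigr => l _; rewrite tnth_mktuple.
  by apply: eq_bigr => l _; rewrite tnth_mktuple.
rewrite normr_prod prodr_ile1// => j' /negPf j'j.
rewrite normr_ge0 /=; apply: le_trans (ler_norm_sum _ _ _) _.
apply: (@le_trans _ _ (\sum_(i < m.+1) m.+1%:R^-1)); last first.
  by rewrite sumr_const card_ord -[leLHS]mulr_natr mulVf// pnatr_eq0.
apply: ler_sum => i _; rewrite /h j'j mulr1 normrM ger0_norm ?invr_ge0//.
rewrite ler_piMr ?invr_ge0// ger0_norm.
  by rewrite prodr_ile1// => l _; rewrite bern_ge0// bern_le1.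
by apply: prodr_ge0 => l _; rewrite bern_ge0.
Qed.

End score_identity.

(** * Euclidean geometry *)

Section euclidean_facts.
Context {R : realType} {d : nat}.
Implicit Types u v w : 'rV[R]_d.

Lemma dotpC u v : dotp u v = dotp v u.
Proof. by apply: eq_bigr => j _; rewrite mulrC. Qed.

Lemma dotpDl u v w : dotp (u + v) w = dotp u w + dotp v w.
Proof. by rewrite /dotp -big_split; apply: eq_bigr => j _; rewrite mxE mulrDl. Qed.

Lemma dotpZl (c : R) u v : dotp (c *: u) v = c * dotp u v.
Proof. by rewrite /dotp mulr_sumr; apply: eq_bigr => j _; rewrite mxE mulrA. Qed.

Lemma dotpNl u v : dotp (- u) v = - dotp u v.
Proof. by rewrite -scaleN1r dotpZl mulN1r. Qed.

Lemma dotpBl u v w : dotp (u - v) w = dotp u w - dotp v w.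
Proof. by rewrite dotpDl dotpNl. Qed.

Lemma dotpDr u v w : dotp u (v + w) = dotp u v + dotp u w.
Proof. by rewrite dotpC dotpDl !(dotpC _ u). Qed.

Lemma dotpBr u v w : dotp u (v - w) = dotp u v - dotp u w.
Proof. by rewrite dotpC dotpBl !(dotpC _ u). Qed.

Lemma dotpZr (c : R) u v : dotp u (c *: v) = c * dotp u v.
Proof. by rewrite dotpC dotpZl dotpC. Qed.

Lemma dotp_suml (I : finType) (f : I -> 'rV[R]_d) v :
  dotp (\sum_i f i) v = \sum_i dotp (f i) v.
Proof.
rewrite /dotp exchange_big; apply: eq_bigr => j _.
by rewrite summxE mulr_suml.
Qed.

Lemma dotp_ge0 u : 0 <= dotp u u.
Proof. by apply: sumr_ge0 => j _; rewrite -expr2 sqr_ge0. Qed.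

Lemma enorm_ge0 u : 0 <= enorm u.
Proof. exact: sqrtr_ge0. Qed.

Lemma sqr_enorm u : enorm u ^+ 2 = dotp u u.
Proof. by rewrite sqr_sqrtr// dotp_ge0. Qed.

Lemma enorm0 : enorm (0 : 'rV[R]_d) = 0.
Proof.
by rewrite /enorm /dotp big1 ?sqrtr0// => j _; rewrite mxE mul0r.
Qed.

Lemma enorm_cst (c : R) u : 0 <= c -> (forall j, `|u 0 j| = c) ->
  enorm u = c * Num.sqrt d%:R.
Proof.
move=> c0 uc; rewrite /enorm /dotp.
rewrite (eq_bigr (fun=> c ^+ 2)) => [|j _].
  by rewrite sumr_const card_ord -[c ^+ 2 *+ d]mulr_natr sqrtrM ?sqr_ge0// sqrtr_sqr ger0_norm.
by rewrite -expr2 -real_normK ?num_real// uc.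
Qed.

Lemma enorm_le_bound (c : R) u : 0 <= c -> (forall j, `|u 0 j| <= c) ->
  enorm u <= c * Num.sqrt d%:R.
Proof.
move=> c0 uc; have -> : c * Num.sqrt d%:R = Num.sqrt (c ^+ 2 * d%:R).
  by rewrite sqrtrM ?sqr_ge0// sqrtr_sqr ger0_norm.
rewrite ler_wsqrtr// mulr_natr -[X in _ *+ X]card_ord -sumr_const.
apply: ler_sum => j _; rewrite -expr2 -real_normK ?num_real//.
by rewrite lerXn2r ?nnegrE.
Qed.

(** Cauchy-Schwarz: the polynomial [t |-> dotp (v - t *: u) (v - t *: u)] is
    nonnegative, in particular at its minimiser. *)
Lemma dotp_le_enorm u v : `|dotp u v| <= enorm u * enorm v.
Proof.
have D0 t : 0 <= dotp v v - 2 * t * dotp u v + t ^+ 2 * dotp u u.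
  have -> : dotp v v - 2 * t * dotp u v + t ^+ 2 * dotp u u =
      dotp (v - t *: u) (v - t *: u); last exact: dotp_ge0.
  by rewrite dotpBl !dotpBr !dotpZl !dotpZr (dotpC v u); ring.
rewrite -(ler_pXn2r (_ : (0 < 2)%N))// ?nnegrE ?mulr_ge0 ?enorm_ge0//.
rewrite exprMn !sqr_enorm real_normK ?num_real//.
have [u0|u0] := eqVneq (dotp u u) 0.
  have [->|c0] := eqVneq (dotp u v) 0; first by rewrite u0 mul0r expr0n.
  have := D0 ((dotp v v + 1) / (2 * dotp u v)); rewrite u0 mulr0 addr0.
  have -> : dotp v v - 2 * ((dotp v v + 1) / (2 * dotp u v)) * dotp u v = -1.
    by field.
  by rewrite lerNr oppr0 ler10.
have upos : 0 < dotp u u by rewrite lt_neqAle eq_sym u0 dotp_ge0.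
have := D0 (dotp u v / dotp u u).
have -> : dotp v v - 2 * (dotp u v / dotp u u) * dotp u v +
    (dotp u v / dotp u u) ^+ 2 * dotp u u =
    (dotp u u * dotp v v - dotp u v ^+ 2) / dotp u u by field.
by rewrite pmulr_lge0 ?invr_gt0// subr_ge0.
Qed.

Lemma dotp_le u v (b c : R) : enorm u <= b -> enorm v <= c -> `|dotp u v| <= b * c.
Proof.
by move=> ub vc; apply: le_trans (dotp_le_enorm u v) _; rewrite ler_pM ?enorm_ge0.
Qed.

Lemma coord_le_enorm u j : `|u 0 j| <= enorm u.
Proof.
rewrite -sqrtr_sqr ler_wsqrtr// /dotp (bigD1 j)//= -expr2 lerDl.
by apply: sumr_ge0 => i _; rewrite -expr2 sqr_ge0.
Qed.

End euclidean_facts.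

(** * Exponential moments of the score *)

Section score_moments.
Context {R : realType} {d : nat}.
Variables (a B : R) (p : 'I_d -> R) (v : 'rV[R]_d).
Hypotheses (a_gt0 : 0 < a) (a_le : a <= 1 / 2) (pa : forall j, `|p j| <= a).
Hypotheses (B_gt0 : 0 < B) (vB : enorm v <= B).
Implicit Types z : d.-tuple bool.

Definition score_row (a0 : R) (p0 : 'I_d -> R) z : 'rV[R]_d :=
  \row_j score a0 (p0 j) (tnth z j).

Local Notation E := (prodE (fun j => bern (p j))).

Let p_le1 j : `|p j| <= 1.
Proof. by apply: le_trans (pa j) (le_trans a_le _); lra. Qed.

Let bern0 j b : 0 <= bern (p j) b.
Proof. exact: bern_ge0. Qed.

Let bern1 j : \sum_b bern (p j) b = 1.
Proof. exact: bern_sum1. Qed.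

Lemma score_row_mean : E (fun z => dotp (score_row a p z) v) = 0.
Proof.
rewrite /dotp prodE_sum big1// => j _.
rewrite (eq_prodE _ (H := fun z => v 0 j * score a (p j) (tnth z j))); last first.
  by move=> z; rewrite mxE mulrC.
rewrite prodEZ (prodE_marginal bern1 j) score_mean ?mulr0//.
exact: le_trans (pa j) a_le.
Qed.

Lemma enorm_score_row z : enorm (score_row a p z) <= 2 * a ^+ 2 * Num.sqrt d%:R.
Proof.
apply: enorm_le_bound => [|j]; first by rewrite mulr_ge0 ?sqr_ge0.
by rewrite mxE score_bound.
Qed.

Lemma expR_le_quad (x : R) : `|x| <= 1 / 2 -> expR x <= 1 + x + 2 * x ^+ 2.
Proof.
rewrite ler_norml => /andP[xl xu].
have x1 : 0 < 1 - x by lra.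
have : expR x <= (1 - x)^-1.
  rewrite -[leLHS]invrK -expRN lef_pV2 ?posrE ?expR_gt0//.
  exact: expR_ge1Dx.
move=> /le_trans; apply; rewrite -[leLHS]mul1r ler_pdivrMr//.
have : 0 <= x ^+ 2 * (1 - 2 * x) by rewrite mulr_ge0 ?sqr_ge0//; lra.
by lra.
Qed.

(* With this choice each coordinate of the exponent is at most 1/2 in absolute
   value, where the quadratic bound on [expR] applies. *)
Let lam : R := (4 * a ^+ 2 * B)^-1.

Let lam_gt0 : 0 < lam.
Proof. by rewrite invr_gt0 !mulr_gt0// exprn_gt0. Qed.

(** Sub-Gaussian tails: the coordinates of the score are independent, centred
    and bounded by [2 * a ^+ 2], so each contributes a factor at most
    [expR (v_j ^+ 2 / (2 * B ^+ 2))] and the exponents add up to at most [1/2]. *)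
Lemma score_row_mgf : E (fun z => expR (lam * dotp (score_row a p z) v)) <= 2.
Proof.
rewrite (eq_prodE _ (H := fun z =>
    \prod_j expR (lam * (score a (p j) (tnth z j) * v 0 j)))); last first.
  by move=> z; rewrite -expR_sum /dotp mulr_sumr; under eq_bigr do rewrite mxE.
rewrite (prodE_prod _ (fun j b => expR (lam * (score a (p j) b * v 0 j)))).
apply: (@le_trans _ _ (\prod_j expR (v 0 j ^+ 2 / (2 * B ^+ 2)))).
  apply: ler_prod => j _; apply/andP; split.
    by apply: sumr_ge0 => b _; rewrite mulr_ge0 ?bern0 ?expR_ge0.
  have p2 : `|p j| <= 1 / 2 by exact: le_trans (pa j) a_le.
  apply: le_trans _ (expR_ge1Dx _).
  have vj : `|v 0 j| <= B by exact: le_trans (coord_le_enorm _ _) vB.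
  pose x b := lam * (score a (p j) b * v 0 j).
  have xb b : `|x b| <= `|v 0 j| / (2 * B).
    rewrite /x normrM (gtr0_norm lam_gt0) [X in lam * X]normrM.
    apply: (@le_trans _ _ (lam * (2 * a ^+ 2 * `|v 0 j|))).
      by rewrite ler_wpM2l ?(ltW lam_gt0)// ler_wpM2r// score_bound.
    by rewrite le_eqVlt; apply/orP; left; apply/eqP; rewrite /lam; field; rewrite !gt_eqF.
  have x12 b : `|x b| <= 1 / 2.
    apply: le_trans (xb b) _; rewrite ler_pdivrMr ?mulr_gt0//.
    by apply: le_trans vj _; lra.
  apply: (@le_trans _ _ (\sum_b bern (p j) b *
      (1 + x b + 2 * (v 0 j ^+ 2 / (4 * B ^+ 2))))).
    apply: ler_sum => b _; rewrite ler_wpM2l//.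
    apply: le_trans (expR_le_quad (x12 b)) _; rewrite lerD2l ler_wpM2l//.
    have -> : v 0 j ^+ 2 / (4 * B ^+ 2) = (`|v 0 j| / (2 * B)) ^+ 2.
      by rewrite exprMn real_normK ?num_real//; field; rewrite gt_eqF.
    by rewrite -[leLHS]real_normK ?num_real// lerXn2r ?nnegrE// divr_ge0// mulr_ge0// ltW.
  have -> : \sum_b bern (p j) b * (1 + x b + 2 * (v 0 j ^+ 2 / (4 * B ^+ 2))) =
      (\sum_b bern (p j) b) * (1 + 2 * (v 0 j ^+ 2 / (4 * B ^+ 2))) +
      lam * v 0 j * \sum_b bern (p j) b * score a (p j) b.
    by rewrite !sum_bool /x; ring.
  rewrite bern1 score_mean// mulr0 addr0 mul1r lerD2l.
  by rewrite le_eqVlt; apply/orP; left; apply/eqP; field; rewrite gt_eqF.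
rewrite -expR_sum -mulr_suml.
apply: (@le_trans _ _ (expR (1 / 2))).
  rewrite ler_expR ler_pdivrMr ?mulr_gt0 ?exprn_gt0//.
  have -> : \sum_j v 0 j ^+ 2 = enorm v ^+ 2.
    by rewrite sqr_enorm; apply: eq_bigr => j _; rewrite expr2.
  have : enorm v ^+ 2 <= B ^+ 2 by rewrite lerXn2r ?nnegrE ?enorm_ge0// ltW.
  lra.
have := @expR_le_quad (1 / 2); rewrite ger0_norm; last by lra.
by move=> /(_ (lexx _)) /le_trans; apply; lra.
Qed.

End score_moments.

Section score_tails.
Context {R : realType} {d : nat}.
Variables (a B : R) (p : 'I_d -> R) (v : 'rV[R]_d).
Hypotheses (a_gt0 : 0 < a) (a_le : a <= 1 / 2) (pa : forall j, `|p j| <= a).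
Hypotheses (B_gt0 : 0 < B) (vB : enorm v <= B).

Local Notation E := (prodE (fun j => bern (p j))).

Let bern0 j b : 0 <= bern (p j) b.
Proof. by apply: bern_ge0; apply: le_trans (pa j) (le_trans a_le _); lra. Qed.

Let lam : R := (4 * a ^+ 2 * B)^-1.

Let lam_gt0 : 0 < lam.
Proof. by rewrite invr_gt0 !mulr_gt0// exprn_gt0. Qed.

Let lamV_ge0 : 0 <= lam^-1.
Proof. by rewrite ltW// invr_gt0. Qed.

(** The mean absolute score is of the order of [a ^+ 2 * B], with no factor
    depending on the dimension: this is what makes the final rate grow like the
    square root of the dimension. *)
Lemma score_row_abs :
  E (fun z => `|dotp (score_row a p z) v|) <= 16 * a ^+ 2 * B.
Proof.
have vBN : enorm (- v) <= B.
  by rewrite /enorm -scaleN1r dotpZl dotpZr mulrA mulrNN mulr1 mul1r.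
pose f w (z : d.-tuple bool) := expR (lam * dotp (score_row a p z) w).
apply: (@le_trans _ _ (E (fun z => lam^-1 * (f v z + f (- v) z)))).
  apply: prodE_le => // z; rewrite ler_pdivlMl//.
  rewrite /f -scaleN1r dotpZr mulN1r mulrN; set x := dotp _ _.
  rewrite -[X in X * _]gtr0_norm// -normrM; set y := lam * x.
  have := expR_ge1Dx y; have := expR_ge1Dx (- y).
  have := expR_gt0 y; have := expR_gt0 (- y).
  by case: (ger0P y); lra.
rewrite prodEZ prodED.
have -> : 16 * a ^+ 2 * B = lam^-1 * (2 + 2).
  by rewrite /lam invrK; ring.
rewrite ler_wpM2l ?lamV_ge0//.
by apply: lerD; apply: score_row_mgf.
Qed.

(** Chernoff bound: beyond a level proportional to [eps] the tail is so small that
    it remains bounded after multiplication by [expR eps]. *)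
Lemma score_row_excess (eps : R) :
  expR eps * E (fun z => Num.max 0 (dotp (score_row a p z) v - 4 * a ^+ 2 * B * eps))
    <= 8 * a ^+ 2 * B.
Proof.
rewrite -prodEZ.
apply: (@le_trans _ _ (E (fun z => lam^-1 *
    expR (lam * dotp (score_row a p z) v)))).
  apply: prodE_le => // z; set x := dotp _ _.
  have -> : 4 * a ^+ 2 * B * eps = lam^-1 * eps by rewrite /lam invrK.
  have -> : expR (lam * x) = expR eps * expR (lam * x - eps).
    by rewrite -expRD; congr expR; ring.
  rewrite mulrCA ler_wpM2l ?expR_ge0// ge_max.
  rewrite mulr_ge0 ?expR_ge0//=.
  rewrite -(ler_pM2l lam_gt0) mulrA divff ?gt_eqF// mul1r mulrBr mulrA divff ?gt_eqF// mul1r.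
  by apply: le_trans (expR_ge1Dx _); rewrite lerDr.
rewrite prodEZ; have -> : 8 * a ^+ 2 * B = lam^-1 * 2.
  by rewrite /lam invrK; ring.
by rewrite ler_wpM2l ?lamV_ge0// score_row_mgf.
Qed.

End score_tails.

(** * Expectations of bounded random variables *)

Section bounded_expectation.
Context {dT : measure_display} {T : measurableType dT} {R : realType}.
Variable Q : probability T R.
Implicit Types f g : T -> R.

Definition bounded_measurable f :=
  measurable_fun setT f /\ exists c : R, forall x, `|f x| <= c.

Lemma bounded_measurable_integrable f :
  bounded_measurable f -> Q.-integrable setT (EFin \o f).
Proof.
move=> [mf [c fc]]; apply: measurable_bounded_integrable => //.
  exact: fin_num_fun_lty.
exists c; split; first exact: num_real.
by move=> y cy x _ /=; apply: le_trans (fc x) (ltW cy).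
Qed.

Lemma bounded_measurable_cst (c : R) : bounded_measurable (fun=> c).
Proof. by split; [exact: measurable_cst|exists `|c|]. Qed.

Lemma bounded_measurableD f g : bounded_measurable f -> bounded_measurable g ->
  bounded_measurable (fun x => f x + g x).
Proof.
move=> [mf [c fc]] [mg [c' gc]]; split; first exact: (measurable_funD mf mg).
by exists (c + c') => x; apply: le_trans (ler_normD _ _) _; exact: lerD.
Qed.

Lemma bounded_measurableZ (c : R) f : bounded_measurable f ->
  bounded_measurable (fun x => c * f x).
Proof.
move=> [mf [c' fc]]; split; first exact: measurable_funM.
by exists (`|c| * c') => x; rewrite normrM ler_wpM2l.
Qed.

Lemma bounded_measurable_sum (I : finType) (F : I -> T -> R) :
  (forall i, bounded_measurable (F i)) ->
  bounded_measurable (fun x => \sum_i F i x).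
Proof.
move=> bF; split; first by apply: measurable_sum => i; exact: (bF i).1.
have /choice[c cF] := fun i => (bF i).2.
exists (\sum_i c i) => x; apply: le_trans (ler_norm_sum _ _ _) _.
by apply: ler_sum => i _.
Qed.

Lemma bounded_measurable_indic (A : set T) : measurable A ->
  bounded_measurable (\1_A : T -> R).
Proof.
move=> mA; split; first exact: measurable_indic.
by exists 1 => x; rewrite indicE; case: (_ \in _); rewrite ?normr1 ?normr0.
Qed.

Lemma mean_cst (c : R) : \int[Q]_x c = c.
Proof.
rewrite Rintegral_cst// -[RHS]mulr1; congr (_ * _).
exact: (congr1 fine (probability_setT Q)).
Qed.

Lemma meanD f g : bounded_measurable f -> bounded_measurable g ->
  \int[Q]_x (f x + g x) = \int[Q]_x f x + \int[Q]_x g x.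
Proof. by move=> bf bg; rewrite RintegralD//; exact: bounded_measurable_integrable. Qed.

Lemma meanZ (c : R) f : bounded_measurable f ->
  \int[Q]_x (c * f x) = c * \int[Q]_x f x.
Proof. by move=> bf; rewrite RintegralZl//; exact: bounded_measurable_integrable. Qed.

Lemma mean_sum (I : finType) (F : I -> T -> R) :
  (forall i, bounded_measurable (F i)) ->
  \int[Q]_x (\sum_i F i x) = \sum_i \int[Q]_x F i x.
Proof.
move=> bF.
have H (s : seq I) : bounded_measurable (fun x => \sum_(i <- s) F i x) /\
    \int[Q]_x (\sum_(i <- s) F i x) = \sum_(i <- s) \int[Q]_x F i x.
  elim: s => [|i s [bs IH]].
    have -> : (fun x => \sum_(i <- [::]) F i x) = fun=> 0.
      by apply/funext => x; rewrite big_nil.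
    by split; [exact: bounded_measurable_cst|rewrite mean_cst big_nil].
  have -> : (fun x => \sum_(j <- i :: s) F j x) =
      fun x => F i x + \sum_(j <- s) F j x.
    by apply/funext => x; rewrite big_cons.
  by split; [exact: bounded_measurableD|rewrite meanD// IH big_cons].
exact: (H _).2.
Qed.

Lemma mean_le f g : bounded_measurable f -> bounded_measurable g ->
  (forall x, f x <= g x) -> \int[Q]_x f x <= \int[Q]_x g x.
Proof.
by move=> bf bg fg; apply: le_Rintegral => //; exact: bounded_measurable_integrable.
Qed.

Lemma mean_indic (A : set T) : measurable A ->
  \int[Q]_x (\1_A x : R) = fine (Q A).
Proof. by move=> mA; rewrite /Rintegral integral_indic// setIT. Qed.

End bounded_expectation.

(** * From events to expectations *)

Section transfer.
Context {dT : measure_display} {T : measurableType dT} {R : realType}.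
Variable Q : probability T R.
Implicit Types f g : T -> R.

Let staircase (h : R) (N : nat) (x : R) : R :=
  \sum_(k < N) h * (k%:R * h < x)%R%:R.

Let staircase_ge (h : R) N (x : R) : 0 < h -> x <= N%:R * h -> x <= staircase h N x.
Proof.
move=> h0; rewrite /staircase; elim: N => [|N IH].
  by rewrite mul0r big_ord0.
rewrite -natr1 mulrDl mul1r big_ord_recr /= => xN.
have [xle|xgt] := leP x (N%:R * h).
  by rewrite mulr0 addr0 IH.
rewrite mulr1; apply: le_trans xN _; rewrite lerD2r.
rewrite (eq_bigr (fun=> h)) => [|k _].
  by rewrite sumr_const card_ord mulr_natl.
rewrite (lt_trans _ xgt) ?mulr1// ltr_pM2r// ltr_nat; exact: ltn_ord.
Qed.

Let staircase_le (h : R) N (x : R) : 0 < h -> 0 <= x -> staircase h N x <= x + h.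
Proof.
move=> h0 x0; rewrite /staircase.
suff : (\sum_(k < N) h * (k%:R * h < x)%R%:R <= N%:R * h) /\
    \sum_(k < N) h * (k%:R * h < x)%R%:R <= x + h by case.
elim: N => [|N [IH1 IH2]].
  by rewrite big_ord0 mul0r; split=> //; rewrite addr_ge0// ltW.
rewrite -natr1 mulrDl mul1r big_ord_recr /=.
have [xle|xgt] := leP x (N%:R * h).
  by rewrite mulr0 addr0; split=> //; apply: le_trans IH1 _; rewrite lerDl ltW.
by rewrite mulr1 !lerD2r; split=> //; apply: le_trans IH1 (ltW xgt).
Qed.

Lemma measurable_gt f (t : R) : measurable_fun setT f ->
  measurable [set x | t < f x].
Proof.
move=> mf; have := mf measurableT `]t, +oo[%classic (measurable_itv _).
rewrite setTI (_ : f @^-1` _ = [set x | t < f x])//.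
by apply/seteqP; split => x; rewrite /= in_itv /= andbT.
Qed.

(** The privacy inequality extends from events to bounded random variables: by
    integration over the superlevel sets, here discretised into finitely many
    levels whose mesh then tends to zero. *)
Lemma mean_transfer f g (m e delta : R) :
  bounded_measurable f -> bounded_measurable g -> 0 <= e -> 0 < m ->
  (forall x, 0 <= f x <= m) -> (forall x, 0 <= g x) ->
  (forall t : R, (Q [set x | (t < f x)%R] <=
     e%:E * Q [set x | (t < g x)%R] + delta%:E)%E) ->
  \int[Q]_x f x <= e * \int[Q]_x g x + delta * m.
Proof.
move=> bf bg e0 m0 f0 g0 fg; apply/ler_addgt0Pl => eta eta0.
have [N Nlt] : exists N : nat, e * m / eta < N.+1%:R.
  by exists (Num.truncn (e * m / eta)); exact: truncnS_gt.
have N0 : 0 < N.+1%:R :> R by rewrite ltr0n.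
pose h := m / N.+1%:R; have h0 : 0 < h by rewrite divr_gt0.
have mh : m = N.+1%:R * h by rewrite mulrC mulfVK// gt_eqF.
have stairE (u : T -> R) : staircase h N.+1 \o u =
    fun x => \sum_(k < N.+1) h * \1_[set y | k%:R * h < u y] x.
  by apply/funext => x; apply: eq_bigr => k _; rewrite indicE mem_setE.
have mlev (u : T -> R) (k : nat) : bounded_measurable u -> measurable [set y | k%:R * h < u y].
  by move=> [mu _]; exact: measurable_gt.
have bstair (u : T -> R) : bounded_measurable u ->
    bounded_measurable (staircase h N.+1 \o u).
  move=> bu; rewrite stairE; apply: bounded_measurable_sum => k.
  by apply/bounded_measurableZ/bounded_measurable_indic/mlev.
have mean_stair (u : T -> R) : bounded_measurable u ->
    \int[Q]_x (staircase h N.+1 (u x)) =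
    \sum_(k < N.+1) h * fine (Q [set y | k%:R * h < u y]).
  move=> bu; rewrite -[LHS]/(\int[Q]_x ((staircase h N.+1 \o u) x)) stairE.
  rewrite mean_sum => [|k]; last first.
    by apply/bounded_measurableZ/bounded_measurable_indic/mlev.
  apply: eq_bigr => k _; rewrite meanZ ?mean_indic//; first exact: mlev.
  by apply/bounded_measurable_indic/mlev.
apply: (@le_trans _ _ (\int[Q]_x staircase h N.+1 (f x))).
  apply: mean_le => // [|x]; first exact: (bstair f).
  by apply: staircase_ge => //; rewrite -mh; case/andP : (f0 x).
rewrite mean_stair//.
apply: (@le_trans _ _ (e * \int[Q]_x (staircase h N.+1 (g x)) + delta * m)).
  have -> : delta * m = \sum_(k < N.+1) h * delta.
    by rewrite sumr_const card_ord -[RHS]mulr_natl mh; ring.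
  rewrite mean_stair// mulr_sumr -big_split /=.
  apply: ler_sum => k _; rewrite (mulrCA e) -mulrDr ler_wpM2l ?(ltW h0)//.
  have := fg (k%:R * h); rewrite -lee_fin EFinD EFinM !fineK//;
    by apply: fin_num_measure; exact: mlev.
rewrite addrA lerD2r.
apply: (@le_trans _ _ (e * (\int[Q]_x g x + h))); last first.
  rewrite mulrDr [leRHS]addrC lerD2l /h mulrA ler_pdivrMr// [leRHS]mulrC -ler_pdivrMr//.
  exact: ltW.
rewrite ler_wpM2l// -[X in _ + X](mean_cst Q) -meanD//; last exact: bounded_measurable_cst.
apply: mean_le => // [||x]; first exact: (bstair g).
  by apply: bounded_measurableD => //; exact: bounded_measurable_cst.
exact: staircase_le.
Qed.

End transfer.

Section finite_space.
Context {dT : measure_display} {T : measurableType dT} {R : realType}.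
Hypothesis mT : forall A : set T, measurable A.

Lemma mean_finite (Q : probability T R) (I : finType) (e : I -> T) (f : T -> R) :
  bijective e -> \int[Q]_x f x = \sum_i f (e i) * fine (Q [set e i]).
Proof.
move=> [e' eK e'K].
have fE : f = fun x => \sum_i f (e i) * \1_[set e i] x.
  apply/funext => x; rewrite (bigD1 (e' x))//= e'K big1 => [|i ix].
    by rewrite indicE mem_set// mulr1 addr0.
  rewrite indicE memNset ?mulr0// => xi; move/eqP: ix; apply.
  by rewrite (_ : x = e i) ?eK.
rewrite [in LHS]fE mean_sum => [|i]; last first.
  exact/bounded_measurableZ/bounded_measurable_indic.
by apply: eq_bigr => i _; rewrite meanZ ?mean_indic//; exact: bounded_measurable_indic.
Qed.

End finite_space.

Lemma measurable_set1_tuple d (T : measurableType d) n :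
  (forall x : T, measurable [set x]) ->
  forall s : n.-tuple T, measurable [set s].
Proof.
move=> mT s.
have -> : [set s] = \bigcap_(i in [set: 'I_n]) ((@tnth n T ^~ i) @^-1` [set tnth s i]).
  apply/seteqP; split => [t -> i _//|t /= h].
  by apply: eq_from_tnth => i; exact: h.
apply: fin_bigcap_measurable; first exact: finite_finset.
by move=> i _; rewrite -[X in measurable X]setTI; exact: measurable_tnth.
Qed.

Lemma measurable_finite d (T : measurableType d) :
  finite_set [set: T] -> (forall x : T, measurable [set x]) ->
  forall A : set T, measurable A.
Proof.
move=> fT mT A; have -> : A = \bigcup_(x in A) [set x].
  by apply/seteqP; split => [x Ax|x [y Ay ->]//]; exists x.
by apply: fin_bigcup_measurable => //; exact: sub_finite_set fT.
Qed.

(** * Privacy and the mean output *)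

Lemma prodE_mean {dT} {T : measurableType dT} {R : realType}
    (Q : probability T R) (I : finType) m (q : 'I_m -> I -> R)
    (f : m.-tuple I -> T -> R) :
  (forall s, bounded_measurable (f s)) ->
  bounded_measurable (fun o => prodE q (fun s => f s o)) /\
  prodE q (fun s => \int[Q]_o f s o) = \int[Q]_o (prodE q (fun s => f s o)).
Proof.
move=> bf; rewrite /prodE; split.
  by apply: bounded_measurable_sum => s; exact: bounded_measurableZ.
rewrite mean_sum => [|s]; last exact: bounded_measurableZ.
by apply: eq_bigr => s _; rewrite meanZ.
Qed.

Section continuity.
Context {R : realType} {d : nat}.
Implicit Types (phi : 'rV[R]_d -> R).

Lemma continuous_dotp_sub (y x0 : 'rV[R]_d) :
  continuous (fun w : 'rV[R]_d => dotp y (w - x0)).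
Proof.
rewrite /dotp; elim: (index_enum _) => [|j s IH].
  have -> : (fun w : 'rV[R]_d => \sum_(j <- [::]) y 0 j * (w - x0) 0 j) = fun=> 0.
    by apply/funext => w; rewrite big_nil.
  exact: cst_continuous.
have -> : (fun w : 'rV[R]_d => \sum_(i <- j :: s) y 0 i * (w - x0) 0 i) =
    fun w => y 0 j * (w 0 j - x0 0 j) + \sum_(i <- s) y 0 i * (w - x0) 0 i.
  by apply/funext => w; rewrite big_cons !mxE.
have c1 : continuous (fun w : 'rV[R]_d => y 0 j * (w 0 j - x0 0 j)).
  move=> w; apply: (@continuousM _ _ (fun=> y 0 j) (fun w : 'rV[R]_d => w 0 j - x0 0 j)).
    exact: cst_continuous.
  apply: (@continuousB _ _ _ (fun w : 'rV[R]_d => w 0 j) (fun=> x0 0 j)).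
    exact: coord_continuous.
  exact: cst_continuous.
move=> w; exact: (continuousD (c1 w) (IH w)).
Qed.

Lemma continuous_hinge (c t : R) (y x0 : 'rV[R]_d) :
  continuous (fun w : 'rV[R]_d => Num.max 0 (c * dotp y (w - x0) - t)).
Proof.
move=> w; apply: (@continuous_max _ _ (fun=> 0)
  (fun w : 'rV[R]_d => c * dotp y (w - x0) - t)); first exact: cst_continuous.
apply: (@continuousB _ _ _ (fun w : 'rV[R]_d => c * dotp y (w - x0)) (fun=> t)).
  apply: (@continuousM _ _ (fun=> c) (fun w : 'rV[R]_d => dotp y (w - x0))).
    exact: cst_continuous.
  exact: continuous_dotp_sub.
exact: cst_continuous.
Qed.

Lemma borel_rV_gt phi (t : R) : continuous phi -> borel_rV [set w | t < phi w].
Proof.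
move=> cphi; apply: sub_sigma_algebra => /=.
rewrite (_ : [set w | _] = phi @^-1` `]t, +oo[%classic); last first.
  by apply/seteqP; split => w /=; rewrite in_itv /= andbT.
by apply: open_comp => [w _|]; [exact: cphi|exact: interval_open].
Qed.

End continuity.

Section mechanism.
Context {R : realType} {d n : nat} {dO : measure_display} {O : measurableType dO}.
Local Notation Z := (d.-tuple bool).
Variables (W : set 'rV[R]_d) (Q : probability O R).
Variables (A : O -> n.-tuple Z -> 'rV[R]_d) (eps delta : R).
Variables (x0 : 'rV[R]_d) (B : R).
Hypotheses (algA : algorithm W A) (privA : diff_private Q eps delta A).
Hypotheses (WB : forall w, W w -> enorm (w - x0) <= B).

Implicit Types (phi : 'rV[R]_d -> R) (s : n.-tuple Z).

Lemma mechanism_measurable phi s : continuous phi ->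
  measurable_fun setT (fun o => phi (A o s)).
Proof.
move=> cphi; apply: (measurability _ (RGenOInfty.measurableE R)) => //.
move=> _ [_ [t ->] <-]; rewrite setTI.
have := algA.2 _ (borel_rV_gt t cphi).
move=> /(measurable_ysection s); congr measurable.
by apply/seteqP; split => o; rewrite ysectionE /= in_itv /= andbT.
Qed.

Lemma mechanism_bounded_measurable phi (c : R) s : continuous phi ->
  (forall w, W w -> `|phi w| <= c) ->
  bounded_measurable (fun o => phi (A o s)).
Proof.
move=> cphi phic; split; first exact: mechanism_measurable.
by exists c => o; apply: phic; exact: algA.1.
Qed.

(** The output enters the argument only through linear functionals, so the
    internal randomness can be averaged out; the output is recentred at [x0]. *)
Definition mean_output s : 'rV[R]_d := \row_j \int[Q]_o (A o s - x0) 0 j.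

Let dotp_bounded y s : bounded_measurable (fun o => dotp y (A o s - x0)).
Proof.
apply: (@mechanism_bounded_measurable (fun w => dotp y (w - x0)) (enorm y * B)).
  exact: continuous_dotp_sub.
by move=> w Ww; apply: dotp_le (lexx _) (WB Ww).
Qed.

Lemma dotp_mean_output y s :
  dotp y (mean_output s) = \int[Q]_o dotp y (A o s - x0).
Proof.
have coordE j : (fun o => (A o s - x0) 0 j) =
    fun o => dotp (delta_mx 0 j) (A o s - x0).
  apply/funext => o; rewrite /dotp (bigD1 j)//= [delta_mx _ _ _ _]mxE !eqxx mul1r big1 ?addr0//.
  by move=> i ij; rewrite [delta_mx _ _ _ _]mxE eqxx (negPf ij) mul0r.
have bc j : bounded_measurable (fun o => (A o s - x0) 0 j).
  by rewrite coordE; exact: dotp_bounded.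
rewrite /dotp mean_sum => [|j]; last exact: bounded_measurableZ.
by apply: eq_bigr => j _; rewrite mxE meanZ.
Qed.

Lemma dotp_mean_output_le y s : `|dotp y (mean_output s)| <= enorm y * B.
Proof.
rewrite dotp_mean_output ler_norml; apply/andP; split.
  rewrite -[leLHS](mean_cst Q); apply: mean_le => // [|o].
    exact: bounded_measurable_cst.
  have := dotp_le (lexx (enorm y)) (WB (algA.1 o s)).
  by rewrite ler_norml => /andP[].
rewrite -[leRHS](mean_cst Q); apply: mean_le => // [|o].
  exact: bounded_measurable_cst.
have := dotp_le (lexx (enorm y)) (WB (algA.1 o s)).
by rewrite ler_norml => /andP[].
Qed.

Lemma private_mean_transfer phi (m : R) s s' : neighbours s s' -> 0 < m ->
  continuous phi -> (forall w, W w -> 0 <= phi w <= m) ->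
  \int[Q]_o phi (A o s) <= expR eps * \int[Q]_o phi (A o s') + delta * m.
Proof.
move=> ss' m0 cphi phim.
have bphi t : bounded_measurable (fun o => phi (A o t)).
  apply: (@mechanism_bounded_measurable phi m) => // w Ww.
  by have /andP[p0 pm] := phim w Ww; rewrite ger0_norm.
apply: mean_transfer => //.
- by move=> o; apply: phim; exact: algA.1.
- by move=> o; have /andP[] := phim _ (algA.1 o s').
- by move=> t; exact: (privA ss' (borel_rV_gt t cphi)).
Qed.

Variables (a : R) (p : 'I_d -> R).
Hypotheses (a_gt0 : 0 < a) (a_le : a <= 1 / 2) (pa : forall j, `|p j| <= a).
Hypotheses (B_gt0 : 0 < B) (d_gt0 : (0 < d)%N).
Hypotheses (eps_gt0 : 0 < eps) (delta_ge0 : 0 <= delta).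

Local Notation y := (score_row a p).
Local Notation E := (prodE (fun j => bern (p j))).
Let m : R := 2 * a ^+ 2 * Num.sqrt d%:R * B.

Let m_gt0 : 0 < m.
Proof. by rewrite !mulr_gt0// ?exprn_gt0// sqrtr_gt0 ltr0n. Qed.

Let ym z w : W w -> `|dotp (y z) (w - x0)| <= m.
Proof. by move=> Ww; apply: dotp_le (WB Ww); exact: enorm_score_row. Qed.

Let bern0 j b : 0 <= bern (p j) b.
Proof. by apply: bern_ge0; apply: le_trans (pa j) (le_trans a_le _); lra. Qed.

Let bern1 j : \sum_b bern (p j) b = 1.
Proof. exact: bern_sum1. Qed.

Let neigh s i z : neighbours (replace s i z) s.
Proof. by exists i => j ji; rewrite tnth_replace (negPf ji). Qed.

Let neigh' s i z : neighbours s (replace s i z).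
Proof. by exists i => j ji; rewrite tnth_replace (negPf ji). Qed.

Let hinge (c t : R) z (w : 'rV[R]_d) : R := Num.max 0 (c * dotp (y z) (w - x0) - t).

Let hinge_bound (c t : R) z w : `|c| <= 1 -> 0 <= t -> W w -> 0 <= hinge c t z w <= m.
Proof.
move=> c1 t0 Ww; rewrite /hinge le_max lexx /= ge_max (ltW m_gt0) /=.
rewrite lerBlDr; apply: le_trans (ler_norm _) _; rewrite normrM.
apply: (@le_trans _ _ (1 * m)); first by rewrite ler_pM// ym.
by rewrite mul1r lerDl.
Qed.

Let hinge_bm (c t : R) z s : `|c| <= 1 -> 0 <= t ->
  bounded_measurable (fun o => hinge c t z (A o s)).
Proof.
move=> c1 t0; apply: (@mechanism_bounded_measurable (hinge c t z) m).
  exact: continuous_hinge.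
by move=> w Ww; have /andP[h0 hm] := hinge_bound z c1 t0 Ww; rewrite ger0_norm.
Qed.

Let hinge_transfer (c t : R) z s s' : `|c| <= 1 -> 0 <= t -> neighbours s s' ->
  \int[Q]_o hinge c t z (A o s) <=
  expR eps * \int[Q]_o hinge c t z (A o s') + delta * m.
Proof.
move=> c1 t0 ss'; apply: private_mean_transfer => //.
  exact: continuous_hinge.
by move=> w; exact: hinge_bound.
Qed.

Let absE s : 
  E (fun z => \int[Q]_o `|dotp (y z) (A o s - x0)|) <= 16 * a ^+ 2 * B.
Proof.
have babs z : bounded_measurable (fun o => `|dotp (y z) (A o s - x0)|).
  have [mf [c fc]] := dotp_bounded (y z) s; split.
    exact: measurableT_comp.
  by exists c => o; rewrite normr_id.
have [bE ->] := prodE_mean Q (fun j => bern (p j)) babs.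
rewrite -[leRHS](mean_cst Q); apply: mean_le => // [|o].
  exact: bounded_measurable_cst.
by apply: score_row_abs => //; apply: WB; exact: algA.1.
Qed.

(** Small budget: the positive and the negative parts are transferred in the
    two opposite directions, so that only the mean absolute correlation gets multiplied
    by [expR eps - 1], while the signed one averages to zero over [z]. *)
Let resampled_score_small s i : eps <= 1 / 2 ->
  E (fun z => dotp (y z) (mean_output (replace s i z))) <=
    32 * eps * a ^+ 2 * B + 2 * delta * m.
Proof.
move=> eps2.
have e1 : expR eps <= 1 + 2 * eps.
  have -> : expR eps = (expR (- eps))^-1 by rewrite expRN invrK.
  have := expR_ge1Dx (- eps) => en.
  apply: (@le_trans _ _ (1 - eps)^-1).
    by rewrite lef_pV2 ?posrE ?expR_gt0//; lra.
  rewrite -[leLHS]mul1r ler_pdivrMr; last by lra.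
  have : 0 <= eps * (1 - 2 * eps) by rewrite mulr_ge0 ?(ltW eps_gt0)//; lra.
  by lra.
apply: (@le_trans _ _ (E (fun z => (dotp (y z) (mean_output s) +
    2 * eps * \int[Q]_o `|dotp (y z) (A o s - x0)|) + 2 * delta * m))); last first.
  rewrite !prodED prodEZ prodE_cst// score_row_mean// add0r lerD2r.
  have -> : 32 * eps * a ^+ 2 * B = 2 * eps * (16 * a ^+ 2 * B) by ring.
  by rewrite ler_wpM2l ?absE// mulr_ge0// ltW.
apply: prodE_le => // z.
have n1 : `|1 : R| <= 1 by rewrite normr1.
have nN1 : `|-1 : R| <= 1 by rewrite normrN normr1.
have l0 : (0 : R) <= 0 by [].
have parts t : dotp (y z) (mean_output t) =
    \int[Q]_o hinge 1 0 z (A o t) + -1 * \int[Q]_o hinge (-1) 0 z (A o t).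
  rewrite dotp_mean_output -(meanZ Q _ (hinge_bm z t nN1 l0)).
  rewrite -(meanD Q (hinge_bm z t n1 l0) (bounded_measurableZ _ (hinge_bm z t nN1 l0))).
  apply: eq_Rintegral => o _; rewrite /hinge !subr0 mul1r !mulN1r.
  by set x := dotp _ _; case: (leP 0 x); case: (leP 0 (- x)); lra.
have partsN : \int[Q]_o `|dotp (y z) (A o s - x0)| =
    \int[Q]_o hinge 1 0 z (A o s) + \int[Q]_o hinge (-1) 0 z (A o s).
  rewrite -(meanD Q (hinge_bm z s n1 l0) (hinge_bm z s nN1 l0)).
  apply: eq_Rintegral => o _; rewrite /hinge !subr0 mul1r !mulN1r.
  by set x := dotp _ _; case: (ger0P x); case: (leP 0 x); case: (leP 0 (- x)); lra.
have up := hinge_transfer z n1 l0 (neigh s i z).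
have dn := hinge_transfer z nN1 l0 (neigh' s i z).
have hp0 : 0 <= \int[Q]_o hinge 1 0 z (A o s).
  by apply: Rintegral_ge0 => o _; have /andP[] := hinge_bound z n1 l0 (algA.1 o s).
have hn0 : 0 <= \int[Q]_o hinge (-1) 0 z (A o s).
  by apply: Rintegral_ge0 => o _; have /andP[] := hinge_bound z nN1 l0 (algA.1 o s).
have hn0' : 0 <= \int[Q]_o hinge (-1) 0 z (A o (replace s i z)).
  apply: Rintegral_ge0 => o _.
  by have /andP[] := hinge_bound z nN1 l0 (algA.1 o (replace s i z)).
rewrite !parts partsN.
move: up dn hp0 hn0 hn0'.
set P' := \int[Q]_o _; set P := \int[Q]_o _.
set N := \int[Q]_o _; set N' := \int[Q]_o _.
have dm : 0 <= delta * m by rewrite mulr_ge0// ltW.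
move=> up dn P0 N0 N'0.
have eP : expR eps * P <= (1 + 2 * eps) * P by rewrite ler_wpM2r.
have eN : expR eps * N' <= (1 + 2 * eps) * N' by rewrite ler_wpM2r.
have N'N : N <= N' \/ eps * N' <= eps * N.
  by case: (leP N N') => NN; [left|right; rewrite ler_wpM2l ?ltW].
have eN0 : 0 <= eps * N by rewrite mulr_ge0// ltW.
by case: N'N => ?; lra.
Qed.

(** Large budget: only the part of the correlation above the level [t] is
    transferred; its sub-Gaussian tail beats the factor [expR eps] as soon as [t]
    is proportional to [eps]. *)
Let resampled_score_large s i : 1 / 2 <= eps ->
  E (fun z => dotp (y z) (mean_output (replace s i z))) <=
    20 * eps * a ^+ 2 * B + delta * m.
Proof.
move=> eps2; pose t := 4 * a ^+ 2 * B * eps.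
have a2B : 0 < a ^+ 2 * B by rewrite mulr_gt0 ?exprn_gt0.
have t0 : 0 <= t by rewrite /t !mulr_ge0 ?sqr_ge0// ltW.
have n1 : `|1 : R| <= 1 by rewrite normr1.
apply: (@le_trans _ _ (E (fun z => (t + delta * m) +
    expR eps * \int[Q]_o hinge 1 t z (A o s)))).
  apply: prodE_le => // z; rewrite dotp_mean_output.
  have := hinge_transfer z n1 t0 (neigh s i z).
  rewrite -(lerD2l t) addrA [X in _ -> _ <= X]addrAC => /(le_trans _); apply.
  rewrite -[X in X + _](mean_cst Q) -(meanD Q _ (hinge_bm z _ n1 t0)); last first.
    exact: bounded_measurable_cst.
  apply: mean_le => // [|o].
    by apply: bounded_measurableD; [exact: bounded_measurable_cst|exact: hinge_bm].
  rewrite /hinge mul1r -lerBlDl le_max; apply/orP; right.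
  exact: lexx.
rewrite prodED prodE_cst// prodEZ.
have hb z : bounded_measurable (fun o => hinge 1 t z (A o s)) by exact: hinge_bm.
have [bE ->] := prodE_mean Q (fun j => bern (p j)) hb.
rewrite -meanZ//.
have excess : \int[Q]_o (expR eps * E (fun z => hinge 1 t z (A o s))) <= 8 * a ^+ 2 * B.
  rewrite -[leRHS](mean_cst Q); apply: mean_le => // [||o].
  - exact: bounded_measurableZ.
  - exact: bounded_measurable_cst.
  rewrite (eq_prodE _ (H := fun z => Num.max 0 (dotp (y z) (A o s - x0) - t))).
    by apply: score_row_excess => //; apply: WB; exact: algA.1.
  by move=> z; rewrite /hinge mul1r.
have : 0 <= a ^+ 2 * B * (eps - 1 / 2) by rewrite mulr_ge0 ?(ltW a2B)//; lra.
by rewrite /t in excess *; lra.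
Qed.

(** The score of a fresh draw [z] has mean zero against an output computed without
    [z]; by privacy the output computed with [z] in place of the [i]-th entry
    cannot correlate with it much more. *)
Lemma resampled_score_le s i :
  E (fun z => dotp (y z) (mean_output (replace s i z))) <=
    a ^+ 2 * B * (32 * eps + 4 * delta * Num.sqrt d%:R).
Proof.
have -> : a ^+ 2 * B * (32 * eps + 4 * delta * Num.sqrt d%:R) =
    32 * eps * a ^+ 2 * B + 2 * delta * m by rewrite /m; ring.
have [eps2|eps2] := leP eps (1 / 2); first exact: resampled_score_small.
apply: le_trans (resampled_score_large _ _ (ltW eps2)) _.
have dm : 0 <= delta * m by rewrite mulr_ge0// ltW.
have : 0 <= eps * a ^+ 2 * B by rewrite !mulr_ge0 ?sqr_ge0// ltW.
lra.
Qed.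

End mechanism.

(** * Correlation of the output with the scores *)

Section correlation.
Context {R : realType} {d n : nat}.
Local Notation Z := (d.-tuple bool).
Variables (a B : R) (p : 'I_d -> R).
Hypotheses (a_gt0 : 0 < a) (a_le : a <= 1 / 2) (pa : forall j, `|p j| <= a).
Hypotheses (B_ge0 : 0 <= B).
Variable v : n.-tuple Z -> 'rV[R]_d.

Let p_le1 j : `|p j| <= 1.
Proof. by apply: le_trans (pa j) (le_trans a_le _); lra. Qed.

Let bern0 j b : 0 <= bern (p j) b.
Proof. exact: bern_ge0. Qed.

Let bern1 j : \sum_b bern (p j) b = 1.
Proof. exact: bern_sum1. Qed.

Let law0 (i : 'I_n) z : 0 <= signs_law p z.
Proof. exact: signs_law_ge0. Qed.

Let law1 (i : 'I_n) : \sum_z signs_law p z = 1.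
Proof. exact: signs_law_sum1. Qed.

Local Notation corr :=
  (sampleE p (fun s => \sum_i dotp (score_row a p (tnth s i)) (v s))).

Lemma correlation_le_resampled (C : R) :
  (forall s i, prodE (fun j => bern (p j)) (fun z =>
     dotp (score_row a p z) (v (replace s i z))) <= C) ->
  corr <= n%:R * C.
Proof.
move=> vC; rewrite /sampleE prodE_sum mulr_natl -[X in _ *+ X]card_ord -sumr_const.
apply: ler_sum => i _; rewrite (prodE_resample law1 i) -[leRHS](prodE_cst law1).
apply: prodE_le => // s; apply: le_trans (vC s i).
rewrite le_eqVlt; apply/orP; left; apply/eqP; apply: eq_bigr => z _.
by rewrite tnth_replace eqxx.
Qed.

(** Without privacy, the total score still has only the length of a sum of [n]
    independent centred vectors. *)
Lemma correlation_le_variance : (0 < n)%N -> (0 < d)%N ->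
  (forall y s, `|dotp y (v s)| <= enorm y * B) ->
  corr <= 2 * a ^+ 2 * Num.sqrt n%:R * Num.sqrt d%:R * B.
Proof.
move=> n0 d0 vB; set tau := 2 * a ^+ 2 * Num.sqrt n%:R * Num.sqrt d%:R.
have tau0 : 0 < tau by rewrite /tau !mulr_gt0// ?exprn_gt0// sqrtr_gt0 ltr0n.
have t2 : 0 < 2 * tau by lra.
pose Y (s : n.-tuple Z) : 'rV[R]_d := \sum_i score_row a p (tnth s i).
have varY : sampleE p (fun s => enorm (Y s) ^+ 2) <= tau ^+ 2.
  have -> : tau ^+ 2 = \sum_(j < d) n%:R * (2 * a ^+ 2) ^+ 2.
    rewrite sumr_const card_ord -[RHS]mulr_natr /tau !exprMn !sqr_sqrtr//.
    by ring.
  rewrite /sampleE (eq_prodE _ (H := fun s : n.-tuple Z =>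
    \sum_j (\sum_i score a (p j) (tnth (tnth s i) j)) ^+ 2)) => [|s].
    rewrite prodE_sum; apply: ler_sum => j _.
    apply: (prodE_sqr_sum law0 law1 (h := fun z => score a (p j) (tnth z j))).
      move=> _; rewrite -[LHS]/(prodE (fun j => bern (p j))
        (fun z => score a (p j) (tnth z j))) (prodE_marginal bern1).
      by rewrite score_mean//; exact: le_trans (pa j) a_le.
    by move=> z; exact: score_bound.
  rewrite sqr_enorm; apply: eq_bigr => j _; rewrite -expr2 /Y summxE.
  by under eq_bigr do rewrite mxE.
apply: (@le_trans _ _ (sampleE p (fun s =>
    B / (2 * tau) * (enorm (Y s) ^+ 2 + tau ^+ 2)))).
  apply: prodE_le => // s; rewrite -dotp_suml.
  apply: le_trans (ler_norm _) _; apply: le_trans (vB _ _) _.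
  rewrite [leRHS]mulrAC ler_pdivlMr//.
  rewrite -/(Y s) -subr_ge0.
  have -> : B * (enorm (Y s) ^+ 2 + tau ^+ 2) - enorm (Y s) * B * (2 * tau) =
    B * (enorm (Y s) - tau) ^+ 2 by ring.
  by rewrite mulr_ge0// sqr_ge0.
rewrite /sampleE prodEZ prodED prodE_cst// -/(sampleE p _).
have -> : tau * B = B / (2 * tau) * (tau ^+ 2 + tau ^+ 2).
  by field; rewrite gt_eqF.
by apply: ler_wpM2l; [exact: divr_ge0 (ltW t2)|rewrite lerD2r].
Qed.

End correlation.

(** * Averaging over the prior *)

Section averaging.
Context {R : realType} {d n : nat}.
Local Notation Z := (d.-tuple bool).

(** By the Bayes identity an output [v] that is only weakly correlated with the
    scores is, on average over the prior, also weakly correlated with the mean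
    [p]; but the best comparator has a correlation proportional to the [l1] norm
    of [p], which averages to at least [d%:R * a / 4]. Some [p] does at least as
    well as the average of the difference. *)
Lemma exists_hard_mean (a B r U : R) (v : n.-tuple Z -> 'rV[R]_d) :
  0 < a <= 1 / 2 -> 0 <= B -> 0 < r ->
  (forall s j, `|v s 0 j| <= B) ->
  (0 < d)%N ->
  (forall p : 'I_d -> R, (forall j, `|p j| <= a) ->
    sampleE p (fun s => \sum_i dotp (score_row a p (tnth s i)) (v s)) <= U) ->
  exists p : 'I_d -> R, (forall j, `|p j| <= a) /\
    r * Num.sqrt d%:R * a / 8 - U / 2 <=
    r / Num.sqrt d%:R * \sum_j `|p j| - sampleE p (fun s => dotp (\row_j p j) (v s)).
Proof.
move=> /andP[a0 a2] B0 r0 vB d0 corrU.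
have sd0 : 0 < Num.sqrt d%:R :> R by rewrite sqrtr_gt0 ltr0n.
pose K : R := (#|{: n.-tuple Z}| * d)%:R * B.
have K0 : 0 <= K by rewrite mulr_ge0.
(* The accuracy of the prior is taken after the number of samples, because the
   discretisation error is summed over all of them. *)
pose eta := r * Num.sqrt d%:R * a / 4 / (K + 1).
have K1 : 0 < K + 1 by lra.
have eta0 : 0 < eta by rewrite !divr_gt0// !mulr_gt0.
have Keta : K * eta <= r * Num.sqrt d%:R * a / 4.
  rewrite /eta mulrA ler_pdivrMr// mulrC ler_wpM2l//; last by lra.
  by rewrite !mulr_ge0 ?invr_ge0// ltW.
have a12 : 0 < a <= 1 / 2 by apply/andP.
have [m [u [ua uprior umean]]] := grid_prior n a12 eta0.
pose q (_ : 'I_d) (_ : 'I_m.+1) : R := m.+1%:R^-1.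
have q0 i x : 0 <= q i x by rewrite invr_ge0.
have q1 i : \sum_x q i x = 1.
  by rewrite sumr_const card_ord -[LHS]mulr_natr mulVf// pnatr_eq0.
pose mean (t : d.-tuple 'I_m.+1) (j : 'I_d) : R := u (tnth t j).
have meana t j : `|mean t j| <= a by exact: ua.
have bern0 t : forall (j : 'I_d) b, 0 <= bern (mean t j) b.
  by move=> j b; apply: bern_ge0; apply: le_trans (meana t j) _; lra.
pose inner t := sampleE (mean t) (fun s => dotp (\row_j mean t j) (v s)).
pose corr t := sampleE (mean t) (fun s =>
  \sum_i dotp (score_row a (mean t) (tnth s i)) (v s)).
have idt : `| prodE q (fun t => corr t - 2 * inner t) | <= K * eta.
  have u1 i : `|u i| <= 1 by apply: le_trans (ua i) _; lra.
  have := @score_identity R d n a B eta m u (fun s j => v s 0 j)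
    u1 B0 (ltW eta0) uprior vB.
  rewrite mulrA; apply: le_trans.
  rewrite le_eqVlt; apply/orP; left; apply/eqP; congr `|_|.
  apply: eq_prodE => t; rewrite /corr /inner /sampleE -[2 * _]prodEZ.
  rewrite -mulN1r -prodEZ -prodED; apply: eq_prodE => s.
  rewrite mulN1r -dotp_suml /dotp mulr_sumr -sumrB; apply: eq_bigr => j _.
  rewrite summxE mxE mulrA -mulrBl; congr ((_ - _) * _).
  by apply: eq_bigr => i _; rewrite mxE.
have sumE : prodE q (fun t => r / Num.sqrt d%:R * \sum_j `|mean t j|) =
    r / Num.sqrt d%:R * (d%:R * \sum_i m.+1%:R^-1 * `|u i|).
  rewrite prodEZ prodE_sum; congr (_ * _).
  rewrite mulr_natl -[X in _ *+ X]card_ord -sumr_const; apply: eq_bigr => j _.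
  by rewrite (prodE_marginal q1 j (fun i => `|u i|)).
have [t lt] := exists_ge_prodE q0 q1 (fun t =>
  r / Num.sqrt d%:R * \sum_j `|mean t j| - inner t).
exists (mean t); split => //; apply: le_trans lt.
have corr_le : prodE q corr <= U.
  by rewrite -[leRHS](prodE_cst q1); apply: (prodE_le q0) => t'; exact: corrU.
have -> : prodE q (fun t => r / Num.sqrt d%:R * \sum_j `|mean t j| - inner t) =
    r / Num.sqrt d%:R * (d%:R * \sum_i m.+1%:R^-1 * `|u i|) - prodE q inner.
  by rewrite -sumE -mulN1r -prodEZ -prodED; apply: eq_prodE => s; rewrite mulN1r.
move: idt; have -> : prodE q (fun t => corr t - 2 * inner t) =
    prodE q corr - 2 * prodE q inner.
  rewrite -mulN1r -!prodEZ -prodED; apply: eq_prodE => s.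
  by rewrite mulN1r.
rewrite ler_norml => /andP[idl _].
have : r * Num.sqrt d%:R * a / 4 <=
    r / Num.sqrt d%:R * (d%:R * \sum_i m.+1%:R^-1 * `|u i|).
  have -> : r / Num.sqrt d%:R * (d%:R * \sum_i m.+1%:R^-1 * `|u i|) =
      r * Num.sqrt d%:R * \sum_i m.+1%:R^-1 * `|u i|.
    rewrite -{2}[d%:R]sqr_sqrtr//; field; exact: lt0r_neq0.
  have rs0 : 0 <= r * Num.sqrt d%:R by apply: mulr_ge0; exact: ltW.
  by rewrite -[leLHS]mulrA ler_wpM2l.
lra.
Qed.

End averaging.

(** * The hard instances and their weak gap *)

Lemma exists_probability {d} {T : measurableType d} {R : realType}
    (I : finType) (e : I -> T) (w : I -> R) :
  (forall i, 0 <= w i) -> \sum_i w i = 1 ->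
  exists P : probability T R, forall A, measurable A ->
    P A = (\sum_i (w i)%:E * \d_(e i) A)%E.
Proof.
move=> w0 w1.
have [i0 _|no_i] := pickP (fun _ : I => true); last first.
  by move: w1; rewrite big1 => [/eqP|i _]; [rewrite eq_sym oner_eq0|have := no_i i].
pose ei k := nth i0 (enum I) k.
pose mu : {measure set T -> \bar R} :=
  msum (fun k => mscale (NngNum (w0 (ei k))) \d_(e (ei k))) #|I|.
have muE A : mu A = (\sum_i (w i)%:E * \d_(e i) A)%E.
  rewrite /mu /msum /= -[RHS]big_enum /=.
  by rewrite [RHS](big_nth i0) -cardE big_mkord.
(* [mu] already has mass 1; normalising it only gives it the structure of a
   probability. *)
exists (mnormalize mu \d_(e i0)) => A mA.
have muT : mu setT = 1%E.
  by rewrite muE; under eq_bigr do rewrite diracT mule1; rewrite sumEFin w1.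
rewrite -[LHS]/(mnormalize mu \d_(e i0) A) /mnormalize muT.
case: ifPn => [/orP[]/eqP//|_]; first by move=> [] /eqP; rewrite oner_eq0.
by rewrite /= invr1 mule1 muE.
Qed.

Section instance.
Context {R : realType} {d n : nat}.
Local Notation Z := (d.-tuple bool).

Lemma measurable_signs (A : set Z) : measurable A.
Proof.
apply: measurable_finite; first exact: finite_finset.
exact: measurable_set1_tuple.
Qed.

Lemma measurable_sample (A : set (n.-tuple Z)) : measurable A.
Proof.
apply: measurable_finite; first exact: finite_finset.
by apply: measurable_set1_tuple => z; exact: measurable_signs.
Qed.

Lemma exists_signs_probability (p : 'I_d -> R) : (forall j, `|p j| <= 1) ->
  exists P : probability Z R, forall z, P [set z] = (signs_law p z)%:E.
Proof.
move=> p1; have [P PE] := exists_probability (@id Z)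
  (fun z => signs_law_ge0 z p1) (signs_law_sum1 p).
exists P => z; rewrite PE; last exact: measurable_signs.
rewrite (bigD1 z)//= diracE mem_set// mule1 big1 ?adde0// => z' z'z.
by rewrite diracE memNset ?mule0// => zz; rewrite zz eqxx in z'z.
Qed.

Lemma sample_mean (p : 'I_d -> R) (P : probability Z R) (f : n.-tuple Z -> R) :
  (forall z, P [set z] = (signs_law p z)%:E) ->
  \int[iid P n]_s f s = sampleE p f.
Proof.
move=> PE; rewrite (mean_finite measurable_sample _ f (e := @id (n.-tuple Z))).
  apply: eq_bigr => s _; rewrite mulrC; congr (_ * _).
  have -> : [set s] = [set t | forall i, [set tnth s i] (tnth t i)].
    apply/seteqP; split => [t -> //|t /= ts].
    by apply: eq_from_tnth => i; exact: ts.
  rewrite (iid_rectangle _ (B := fun i => [set tnth s i])).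
    rewrite (eq_bigr (fun i => (signs_law p (tnth s i))%:E)) ?prodEFin//.
  by move=> i; exact: measurable_signs.
by exists id.
Qed.

(** Constant operators are monotone and Lipschitz for every constant; all the
    information is in the direction, a scaled vector of signs. *)
Definition spin_operator (c : R) (z : Z) (_ : 'rV[R]_d) : 'rV[R]_d :=
  \row_j (- c * spin (tnth z j)).

Lemma mean_spin_operator (c : R) (p : 'I_d -> R) (P : probability Z R) :
  (forall z, P [set z] = (signs_law p z)%:E) ->
  mean_operator P (spin_operator c) = fun=> - c *: \row_j p j.
Proof.
move=> PE; apply/funext => w; apply/rowP => j; rewrite !mxE.
under eq_Rintegral do rewrite mxE.
rewrite (mean_finite measurable_signs _ _ (e := @id Z)); last by exists id.
rewrite (eq_bigr (fun z => - c * (spin (tnth z j) * signs_law p z))) => [|z _]; last first.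
  by rewrite mulrA; congr (_ * _); exact: (congr1 fine (PE z)).
rewrite -mulr_sumr; congr (_ * _).
under eq_bigr do rewrite mulrC.
rewrite -[LHS]/(prodE (fun j => bern (p j)) (fun z => spin (tnth z j))).
by rewrite (prodE_marginal (fun j => bern_sum1 (p j))) bern_mean.
Qed.

Lemma spin_operators_svi (W : set 'rV[R]_d) (L M : R) : (0 < d)%N ->
  0 <= L -> 0 <= M -> svi_operators W L M (spin_operator (M / Num.sqrt d%:R)).
Proof.
move=> d0 L0 M0; split => [z|w j _]; last first.
  by move=> _ B _; exact: measurable_signs.
have sd0 : 0 < Num.sqrt d%:R :> R by rewrite sqrtr_gt0 ltr0n.
split => [u v _ _|u v _ _|u _].
- rewrite subrr /dotp; apply: sumr_ge0 => j _; by rewrite mxE mul0r.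
- by rewrite subrr enorm0 mulr_ge0// enorm_ge0.
- rewrite (@enorm_cst _ _ (M / Num.sqrt d%:R)).
  + by rewrite mulfVK// gt_eqF.
  + by rewrite divr_ge0// ltW.
  move=> j; rewrite mxE normrM normrN [X in X * _]ger0_norm ?divr_ge0 ?(ltW sd0)//.
  by rewrite /spin; case: (tnth z j); rewrite ?normrN normr1 mulr1.
Qed.

End instance.

Section weak_gap_bound.
Context {R : realType} {d n : nat} {dO : measure_display} {O : measurableType dO}.
Local Notation Z := (d.-tuple bool).
Variables (W : set 'rV[R]_d) (Q : probability O R).
Variables (A : O -> n.-tuple Z -> 'rV[R]_d) (x0 : 'rV[R]_d) (B : R).
Hypotheses (algA : algorithm W A).
Hypotheses (WB : forall w, W w -> enorm (w - x0) <= B).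
Variables (p : 'I_d -> R) (P : probability Z R).
Hypothesis PE : forall z, P [set z] = (signs_law p z)%:E.

(** For a constant operator the seed and the comparator [w] enter the inner
    expectation through separate summands, so the supremum commutes with the
    average over the seed: it is a support function of the domain. *)
Lemma weak_gap_ge (g w0 : 'rV[R]_d) : W w0 ->
  ((sampleE p (fun s => dotp g (mean_output Q A x0 s)) + dotp g (x0 - w0))%:E <=
    weak_gap W Q P A (fun=> g))%E.
Proof.
move=> Ww0.
pose h o := sampleE p (fun s => dotp g (A o s - x0)).
pose T := [set dotp g (x0 - w) | w in W].
have bdot s : bounded_measurable (fun o => dotp g (A o s - x0)).
  apply: (mechanism_bounded_measurable algA (phi := fun w => dotp g (w - x0))
    (c := enorm g * B)); first exact: continuous_dotp_sub.
  by move=> w Ww; apply: dotp_le (lexx _) (WB Ww).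
have [bh hE] := prodE_mean Q (fun=> signs_law p) bdot.
have T0 : T !=set0 by exists (dotp g (x0 - w0)), w0.
have Tub : has_ubound T.
  exists (enorm g * B) => _ [w Ww <-]; apply: le_trans (ler_norm _) _.
  by rewrite -[x0 - w]opprB -normrN dotpC dotpNl opprK dotpC; apply: dotp_le (lexx _) (WB Ww).
have innerE o w : \int[iid P n]_s dotp g (A o s - w) = h o + dotp g (x0 - w).
  rewrite (sample_mean _ PE) /h -[X in _ + X](prodE_cst (q := fun=> signs_law p)
    (n := n) (fun _ => signs_law_sum1 p)) -prodED.
  by apply: eq_prodE => s; rewrite -dotpDr addrA subrK.
have supE o : ereal_sup [set (\int[iid P n]_s dotp g (A o s - w))%:E | w in W] =
    (h o + sup T)%:E.
  have -> : [set (\int[iid P n]_s dotp g (A o s - w))%:E | w in W] =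
      EFin @` [set h o + t | t in T].
    apply/seteqP; split => [_ [w Ww <-]|_ [_ [_ [w Ww <-] <-] <-]] /=.
      by rewrite innerE; exists (h o + dotp g (x0 - w)) => //;
        exists (dotp g (x0 - w)) => //; exists w.
    by exists w => //; rewrite innerE.
  have S0 : [set h o + t | t in T] !=set0 by case: T0 => t Tt; exists (h o + t), t.
  have Sub : has_ubound [set h o + t | t in T].
    by case: Tub => c cT; exists (h o + c) => _ [t Tt <-]; rewrite lerD2l cT.
  rewrite ereal_sup_EFin//; congr EFin; apply/eqP; rewrite eq_le; apply/andP; split.
    apply: ge_sup => // _ [t Tt <-]; rewrite lerD2l.
    exact: ub_le_sup.
  rewrite -lerBrDl; apply: ge_sup => // t Tt; rewrite lerBrDl.
  by apply: ub_le_sup => //; exists t.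
rewrite /weak_gap; under eq_integral do rewrite supE.
have bhT : bounded_measurable (fun o => h o + sup T).
  by apply: bounded_measurableD => //; exact: bounded_measurable_cst.
have -> : (\int[Q]_o (h o + sup T)%:E)%E = (\int[Q]_o (h o + sup T))%:E.
  rewrite /Rintegral fineK//.
  by apply: integrable_fin_num => //; exact: bounded_measurable_integrable.
rewrite lee_fin meanD//; last exact: bounded_measurable_cst.
rewrite mean_cst /h -hE; apply: lerD.
  rewrite le_eqVlt; apply/orP; left; apply/eqP; apply: eq_prodE => s.
  exact: dotp_mean_output algA WB _ _.
by apply: ub_le_sup => //; exists w0.
Qed.

End weak_gap_bound.

Section hard_instance.
Context {R : realType} {d n : nat} {dO : measure_display} {O : measurableType dO}.
Local Notation Z := (d.-tuple bool).
Variables (W : set 'rV[R]_d) (Q : probability O R).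
Variables (A : O -> n.-tuple Z -> 'rV[R]_d) (x0 : 'rV[R]_d) (B M r : R).
Hypotheses (d_gt0 : (0 < d)%N) (n_gt0 : (0 < n)%N).
Hypotheses (algA : algorithm W A).
Hypotheses (WB : forall w, W w -> enorm (w - x0) <= B).
Hypotheses (B_gt0 : 0 < B) (M_gt0 : 0 < M) (r_gt0 : 0 < r).
Hypothesis ball_W : eball x0 r `<=` W.

Let sd0 : 0 < Num.sqrt d%:R :> R.
Proof. by rewrite sqrtr_gt0 ltr0n. Qed.

Lemma mean_output_coord s j : `|mean_output Q A x0 s 0 j| <= B.
Proof.
set w := mean_output Q A x0 s; apply: le_trans (coord_le_enorm _ _) _.
have := dotp_mean_output_le Q algA WB w s; rewrite -/w -sqr_enorm.
rewrite ger0_norm ?sqr_ge0//.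
have [->|wpos] := eqVneq (enorm w) 0; first by move=> _; exact: ltW.
by rewrite expr2 ler_pM2l// lt_neqAle eq_sym wpos enorm_ge0.
Qed.

(** The comparator moves from the centre of the ball along the signs of [p]. *)
Lemma weak_gap_of_correlation (a U : R) : 0 < a <= 1 / 2 ->
  (forall p : 'I_d -> R, (forall j, `|p j| <= a) ->
    sampleE p (fun s => \sum_i
      dotp (score_row a p (tnth s i)) (mean_output Q A x0 s)) <= U) ->
  exists P : probability Z R,
    ((M * (r * a / 8 - U / (2 * Num.sqrt d%:R)))%:E <=
     weak_gap W Q P A (mean_operator P (spin_operator (M / Num.sqrt d%:R))))%E.
Proof.
move=> a12 corrU.
have [p [pa hard]] := exists_hard_mean a12 (ltW B_gt0) r_gt0
  mean_output_coord d_gt0 corrU.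
have p1 j : `|p j| <= 1.
  by case/andP : a12 => _ a2; apply: le_trans (pa j) _; lra.
have [P PE] := exists_signs_probability p1.
exists P; rewrite (mean_spin_operator _ PE).
set c := M / Num.sqrt d%:R; have c0 : 0 < c by rewrite divr_gt0.
pose sg : 'rV[R]_d := \row_j Num.sg (p j).
pose w0 := x0 + (r / Num.sqrt d%:R) *: sg.
have rd0 : 0 <= r / Num.sqrt d%:R by rewrite divr_ge0// ltW.
have Ww0 : W w0.
  apply: ball_W; rewrite /eball /= /w0 addrAC subrr add0r.
  apply: (@le_trans _ _ (r / Num.sqrt d%:R * Num.sqrt d%:R)).
    apply: enorm_le_bound => // j; rewrite !mxE normrM (ger0_norm rd0).
    by rewrite ler_piMr// normr_sg; case: (p j != 0).
  by rewrite mulfVK// gt_eqF.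
apply: le_trans (weak_gap_ge Q algA WB PE (- c *: \row_j p j) Ww0).
rewrite lee_fin.
have -> : sampleE p (fun s => dotp (- c *: \row_j p j) (mean_output Q A x0 s)) =
    - c * sampleE p (fun s => dotp (\row_j p j) (mean_output Q A x0 s)).
  by rewrite /sampleE -prodEZ; apply: eq_prodE => s; rewrite dotpZl.
have -> : dotp (- c *: \row_j p j) (x0 - w0) =
    c * (r / Num.sqrt d%:R * \sum_j `|p j|).
  have -> : x0 - w0 = - (r / Num.sqrt d%:R) *: sg.
    by rewrite /w0 opprD addrA subrr add0r scaleNr.
  rewrite dotpZl dotpZr mulrA mulrNN -[LHS]mulrA.
  congr (_ * (_ * _)); apply: eq_bigr => j _.
  by rewrite !mxE normrEsg mulrC.
have -> : M * (r * a / 8 - U / (2 * Num.sqrt d%:R)) =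
    c * (r * Num.sqrt d%:R * a / 8 - U / 2).
  by rewrite /c; field; rewrite gt_eqF.
by rewrite [leRHS]addrC mulNr -mulrBr ler_wpM2l// ltW.
Qed.

Variables (eps delta : R).
Hypotheses (privA : diff_private Q eps delta A).
Hypotheses (eps_gt0 : 0 < eps) (delta_ge0 : 0 <= delta).

(** The statistical rate, best for [a] of the order of [n ^ (-1/2)]. *)
Lemma weak_gap_statistical (a : R) : 0 < a <= 1 / 2 ->
  exists P : probability Z R,
    ((M * (r * a / 8 - a ^+ 2 * B * Num.sqrt n%:R))%:E <=
     weak_gap W Q P A (mean_operator P (spin_operator (M / Num.sqrt d%:R))))%E.
Proof.
move=> a12; have /andP[a0 a2] := a12.
have -> : a ^+ 2 * B * Num.sqrt n%:R =
  2 * a ^+ 2 * Num.sqrt n%:R * Num.sqrt d%:R * B / (2 * Num.sqrt d%:R).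
  by field; rewrite gt_eqF.
apply: weak_gap_of_correlation => // p pa.
apply: correlation_le_variance => //; first exact: ltW.
by move=> y s; exact: dotp_mean_output_le algA WB _ _.
Qed.

(** The privacy rate, best for [a] of the order of
    [min 1 (sqrt d / (eps * n))]. *)
Lemma weak_gap_private (a : R) : 0 < a <= 1 / 2 ->
  exists P : probability Z R,
    ((M * (r * a / 8 - a ^+ 2 * B * (16 * (eps * n%:R / Num.sqrt d%:R)
        + 2 * (n%:R * delta))))%:E <=
     weak_gap W Q P A (mean_operator P (spin_operator (M / Num.sqrt d%:R))))%E.
Proof.
move=> a12; have /andP[a0 a2] := a12.
have -> : a ^+ 2 * B * (16 * (eps * n%:R / Num.sqrt d%:R) + 2 * (n%:R * delta)) =
  n%:R * (a ^+ 2 * B * (32 * eps + 4 * delta * Num.sqrt d%:R)) / (2 * Num.sqrt d%:R).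
  by field; rewrite gt_eqF.
apply: weak_gap_of_correlation => // p pa.
apply: correlation_le_resampled => // s i.
exact: (resampled_score_le algA privA WB).
Qed.

End hard_instance.

Theorem theorem7p2 (R : realType) :
  forall kappa : R, exists (c : R) (k : nat), 0 < c /\
  forall lo hi : nat -> R,
    lo =o_\oo (fun m : nat => m%:R : R) ->
    hi =o_\oo (fun m : nat => m%:R^-1 : R) ->
  exists N : nat, forall (n d : nat) (L M D eps delta : R) (W : set 'rV[R]_d),
    (N <= n)%N -> (0 < n)%N -> (0 < d)%N ->
    0 < L -> 0 < M -> 0 < D -> 0 < eps ->
    2 `^ (- lo n) <= delta -> delta <= hi n ->
    compact W -> convex_set W ->
    (exists x0 : 'rV[R]_d, eball x0 (D / 4) `<=` W) ->
    (forall u v : 'rV[R]_d, W u -> W v -> enorm (u - v) <= kappa * D) ->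
    dp_svi_lower_bound W n L M eps delta
      (c / log_factor n d eps delta ^+ k
        * (M * D * ((Num.sqrt n%:R)^-1
                    + Num.min 1 (Num.sqrt d%:R / (eps * n%:R))))).
Proof.
move=> kappa; pose K := Num.max 1 kappa.
have K1 : 1 <= K by rewrite le_max lexx.
have K0 : 0 < K by apply: lt_le_trans K1.
(* [18 * c' <= 1 / 64] makes the correlation terms below at most half of the
   leading term [D / 4 * a / 8]. *)
have [c' [c'0 c'1 c'le]] : exists c' : R, [/\ 0 < c', c' <= 1 / 2 & 18 * c' <= 1 / 64].
  by exists (1 / 18 * (1 / 64)); split; lra.
have K128 : 0 < 128 * K by apply: mulr_gt0.
exists (c' / (128 * K)), 0%N; split; first exact: divr_gt0.
move=> lo hi _ /eqoP hi_o.
have [N _ hiN] := hi_o 1 ltr01.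
exists N => n d L M D eps delta W Nn n0 d0 L0 M0 D0 eps0 lo_delta delta_hi _ _.
move=> [x0 ball_W] diamW.
have delta0 : 0 <= delta by apply: le_trans lo_delta; exact: powR_ge0.
have ndelta : n%:R * delta <= 1.
  have nR : 0 < n%:R :> R by rewrite ltr0n.
  rewrite mulrC -ler_pdivlMr// mul1r; apply: le_trans delta_hi _.
  apply: le_trans (ler_norm _) _; have := hiN n Nn.
  by rewrite mul1r [X in _ <= X -> _]ger0_norm ?invr_ge0.
have r0 : 0 < D / 4 by rewrite divr_gt0.
have KD0 : 0 < K * D by rewrite mulr_gt0.
have Wx0 : W x0 by apply: ball_W; rewrite /eball /= subrr enorm0 ltW.
have WB w : W w -> enorm (w - x0) <= K * D.
  move=> Ww; apply: le_trans (diamW _ _ Ww Wx0) _.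
  by rewrite ler_wpM2r ?(ltW D0)// le_max lexx orbT.
have sn0 : 0 < Num.sqrt n%:R :> R by rewrite sqrtr_gt0 ltr0n.
have sd0 : 0 < Num.sqrt d%:R :> R by rewrite sqrtr_gt0 ltr0n.
exists (measure_tuple_display default_measure_display), (d.-tuple bool),
  (spin_operator (M / Num.sqrt d%:R)).
split; first by apply: spin_operators_svi => //; exact: ltW.
move=> dO O Q A algA privA.
rewrite expr0 divr1.
set x := (Num.sqrt n%:R)^-1; set y := Num.min 1 _.
have x01 : 0 < x <= 1.
  rewrite invr_gt0 sn0 /= invf_le1// -[leLHS]sqrtr1 ler_wsqrtr//.
  by rewrite ler1n.
have y01 : 0 < y <= 1.
  by rewrite /y lt_min ge_min lexx ltr01 /= andbT divr_gt0// mulr_gt0// ltr0n.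
(* The scale of the prior is of the order of the larger of the two rates. *)
have reduce (t : R) : 0 < t <= 1 -> x <= t -> y <= t ->
    c' / (128 * K) * (M * D * (x + y)) <= M * (D / 4 * (c' / K * t) / 16).
  move=> t01 xt yt.
  have -> : M * (D / 4 * (c' / K * t) / 16) = c' / (128 * K) * (M * D * (2 * t)).
    by field; rewrite gt_eqF.
  apply: ler_wpM2l; first by apply/ltW/divr_gt0.
  by apply: ler_wpM2l; [apply/ltW/mulr_gt0|lra].
have scale (t : R) : 0 < t <= 1 -> 0 < c' / K * t <= 1 / 2.
  move=> /andP[t0 t1]; have cK0 : 0 < c' / K by apply: divr_gt0.
  apply/andP; split; first exact: mulr_gt0.
  have cK : c' / K <= 1 / 2 by rewrite ler_pdivrMr//; lra.
  by have := ler_pM (ltW cK0) (ltW t0) cK t1; rewrite mulr1.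
have [x0' x1] := andP x01; have [y0 y1] := andP y01.
have [yx|/ltW xy] := leP y x.
  have [P gapP] := weak_gap_statistical Q d0 n0 algA WB KD0 M0 r0 ball_W (scale x x01).
  exists P; apply: le_trans gapP; rewrite lee_fin.
  apply: le_trans (reduce x x01 (lexx _) yx) _; apply: ler_wpM2l; first exact: ltW.
  have [] := andP (scale x x01); set a := c' / K * x => a0 _.
  have -> : a ^+ 2 * (K * D) * Num.sqrt n%:R = c' * (a * D).
    by rewrite /a /x; field; rewrite !gt_eqF.
  have : c' * (a * D) <= 1 / 64 * (a * D).
    by apply: ler_wpM2r; [apply/ltW/mulr_gt0|lra].
  lra.
have [P gapP] := weak_gap_private d0 algA WB KD0 M0 r0 ball_W privA eps0 delta0 (scale y y01).
exists P; apply: le_trans gapP; rewrite lee_fin.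
apply: le_trans (reduce y y01 xy (lexx _)) _; apply: ler_wpM2l; first exact: ltW.
have [] := andP (scale y y01); set a := c' / K * y => a0 _.
have yX : y * (eps * n%:R / Num.sqrt d%:R) <= 1.
  have en0 : 0 < eps * n%:R by rewrite mulr_gt0// ltr0n.
  apply: (@le_trans _ _ (Num.sqrt d%:R / (eps * n%:R) * (eps * n%:R / Num.sqrt d%:R))).
    by apply: ler_wpM2r; [apply/ltW/divr_gt0|rewrite /y ge_min lexx orbT].
  by rewrite mulrA divfK ?divff ?gt_eqF.
have yd : y * (n%:R * delta) <= 1.
  rewrite -[leRHS]mulr1; apply: ler_pM => //; first exact: ltW.
  exact: mulr_ge0.
set X := eps * n%:R / _ in yX *; set Y := n%:R * delta in yd *.
have -> : a ^+ 2 * (K * D) * (16 * X + 2 * Y) =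
    c' * (a * D) * (16 * (y * X) + 2 * (y * Y)).
  by rewrite /a; field; rewrite gt_eqF.
have aD0 : 0 <= a * D by apply/ltW/mulr_gt0.
have : c' * (a * D) * (16 * (y * X) + 2 * (y * Y)) <= c' * (a * D) * 18.
  by apply: ler_wpM2l; [apply: mulr_ge0 => //; exact: ltW|lra].
have : 18 * c' * (a * D) <= 1 / 64 * (a * D) by exact: ler_wpM2r.
lra.
Qed.
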